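(* Let $p\in\mathbb{N}$, $p\ge1$, and let $\alpha\in[0,1)$. Let $$\Phi(z)=\sum_{k=1}^p|z|^{2(k-1)}F_{p-k+1}(z)$$ be a $p$-harmonic function in $\mathbb{D}=\{z\in\mathbb{C}:|z|<1\}$ with $\Phi(0)=0$, where $F_{p-k+1}=h_{p-k+1}+\overline{g_{p-k+1}}$ $(k=1,\dots,p)$ are harmonic functions in $\mathbb{D}$ and $h_{p-k+1}$, $g_{p-k+1}$ are analytic in $\mathbb{D}$. Suppose $J_\Phi(z)>0$ in $\mathbb{D}$. Then $\Phi$ is fully $\alpha$-accessible if and only if for every $z\in\mathbb{D}$ $$\sum_{k=1}^p|z|^{2(k-1)}\,\mathrm{Re}\left\{z\left(h'_{p-k+1}(z)\overline{\Phi(z)}-g'_{p-k+1}(z)\Phi(z)\right)\right\}\ \ge\ \sin\frac{\alpha\pi}{2}\cdot|\Phi(z)|\cdot L(z),$$ where $L=\sqrt{A^2+B^2}$ with $$A(z)=\mathrm{Re}\left\{z\sum_{k=1}^p|z|^{2(k-1)}\left(h'_{p-k+1}(z)-g'_{p-k+1}(z)\right)\right\},$$ $$B(z)=\mathrm{Im}\left\{z\sum_{k=1}^p|z|^{2(k-1)}\left(h'_{p-k+1}(z)+g'_{p-k+1}(z)\right)\right\}.$$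
   Context: A complex-valued function $\Phi\in C^{2p}(\mathbb{D})$ is $p$-harmonic in $\mathbb{D}$ if $\Delta^p\Phi=0$ there, where $\Delta=4\frac{\partial^2}{\partial z\,\partial\overline z}$; equivalently it has a representation $\Phi(z)=\sum_{k=1}^p|z|^{2(k-1)}F_{p-k+1}(z)$ with harmonic $F_{p-k+1}$. The Jacobian is $J_\Phi=|\Phi_z|^2-|\Phi_{\overline z}|^2$. Let $\alpha\in[0,1]$. A domain $\Omega\subset\mathbb{R}^n$ is $\alpha$-accessible with respect to a point $a\in\Omega$ if for each finite point $q\in\partial\Omega$ there is $r=r(q)>0$ such that the cone $$K_+(q,a,\alpha,r)=\left\{x\in\mathbb{R}^n:\ \left\langle x-q,\tfrac{q-a}{\|q-a\|}\right\rangle\ge\|x-q\|\cos\left(\tfrac{\alpha\pi}{2}\right),\ \|x-q\|\le r\right\}$$ is contained in $\mathbb{R}^n\setminus\Omega$, where $\langle\cdot,\cdot\rangle$ is the usual inner product. Here $n=2$ and $\mathbb{C}=\mathbb{R}^2$. A $p$-harmonic function $\Phi$ in $\mathbb{D}$ with $\Phi(0)=0$ is fully $\alpha$-accessible, $\alpha\in[0,1)$, if for every $r\in(0,1]$ the function $\Phi$ maps the disk $r\mathbb{D}=\{|z|<r\}$ onto an $\alpha$-accessible domain with respect to the origin. *)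

(* Defs.v *)
From Stdlib Require Import Reals.
From Coquelicot Require Export Coquelicot.

Open Scope R_scope.

Definition disk (r : R) (z : C) : Prop := Cmod z < r.

Definition unit_disk : C -> Prop := disk 1.

Definition image (f : C -> C) (S : C -> Prop) (w : C) : Prop :=
  exists z : C, S z /\ f z = w.

(** "Analytic" means complex differentiable at every point of the open set
    [U]; the complex derivative itself is Coquelicot's [C_derive]. *)
Definition analytic_on (U : C -> Prop) (f : C -> C) : Prop :=
  forall z : C, U z -> ex_derive (K := C_AbsRing) (V := C_NormedModule) f z.

(** A complex-valued function of [z = x + iy] is differentiated componentwise
    in the real variables [x] and [y].  [Derive] is total, so these operators
    are meaningful only where [ex_dx], [ex_dy] hold (see [Cn_on]). *)
Definition dx (f : C -> C) (z : C) : C :=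
  (Derive (fun t : R => Re (f (t, Im z))) (Re z),
   Derive (fun t : R => Im (f (t, Im z))) (Re z)).

Definition dy (f : C -> C) (z : C) : C :=
  (Derive (fun t : R => Re (f (Re z, t))) (Im z),
   Derive (fun t : R => Im (f (Re z, t))) (Im z)).

Definition ex_dx (f : C -> C) (z : C) : Prop :=
  ex_derive (fun t : R => Re (f (t, Im z))) (Re z) /\
  ex_derive (fun t : R => Im (f (t, Im z))) (Re z).

Definition ex_dy (f : C -> C) (z : C) : Prop :=
  ex_derive (fun t : R => Re (f (Re z, t))) (Im z) /\
  ex_derive (fun t : R => Im (f (Re z, t))) (Im z).

(** Real differentiability class C^n on the open set [U]. *)
Fixpoint Cn_on (n : nat) (U : C -> Prop) (f : C -> C) : Prop :=
  (forall z : C, U z ->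
     continuous (T := C_UniformSpace) (U := C_UniformSpace) f z) /\
  match n with
  | O => True
  | S m => (forall z : C, U z -> ex_dx f z /\ ex_dy f z) /\
           Cn_on m U (dx f) /\ Cn_on m U (dy f)
  end.

Definition d_z (f : C -> C) (z : C) : C :=
  (/ RtoC 2 * (dx f z - Ci * dy f z))%C.

Definition d_zbar (f : C -> C) (z : C) : C :=
  (/ RtoC 2 * (dx f z + Ci * dy f z))%C.

Definition laplacian (f : C -> C) (z : C) : C :=
  (RtoC 4 * d_z (d_zbar f) z)%C.

Definition p_harmonic (p : nat) (U : C -> Prop) (f : C -> C) : Prop :=
  Cn_on (2 * p) U f /\
  forall z : C, U z -> Nat.iter p laplacian f z = RtoC 0.

Definition harmonic (U : C -> Prop) (f : C -> C) : Prop := p_harmonic 1 U f.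

Definition jacobian (f : C -> C) (z : C) : R :=
  (Cmod (d_z f z)) ^ 2 - (Cmod (d_zbar f z)) ^ 2.

Definition connected_set (S : C -> Prop) : Prop :=
  forall U V : C -> Prop,
    open (T := C_UniformSpace) U -> open (T := C_UniformSpace) V ->
    (forall z : C, S z -> U z \/ V z) ->
    (exists z : C, S z /\ U z) -> (exists z : C, S z /\ V z) ->
    exists z : C, S z /\ U z /\ V z.

Definition domain (S : C -> Prop) : Prop :=
  open (T := C_UniformSpace) S /\ (exists z : C, S z) /\ connected_set S.

Definition boundary (S : C -> Prop) (q : C) : Prop :=
  forall N : C -> Prop, locally (T := C_UniformSpace) q N ->
    (exists z : C, N z /\ S z) /\ (exists z : C, N z /\ ~ S z).

(** The Euclidean inner product of [C = R^2]. *)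
Definition inner (z w : C) : R := Re z * Re w + Im z * Im w.

Definition cone_plus (q a : C) (alpha r : R) (x : C) : Prop :=
  inner (x - q)%C ((q - a) / RtoC (Cmod (q - a)))%C
    >= Cmod (x - q)%C * cos (alpha * PI / 2) /\
  Cmod (x - q)%C <= r.

Definition accessible (alpha : R) (Omega : C -> Prop) (a : C) : Prop :=
  domain Omega /\ Omega a /\
  forall q : C, boundary Omega q ->
    exists r : R, 0 < r /\ forall x : C, cone_plus q a alpha r x -> ~ Omega x.

Definition fully_accessible (alpha : R) (Phi : C -> C) : Prop :=
  forall r : R, 0 < r <= 1 -> accessible alpha (image Phi (disk r)) (RtoC 0).

Definition A_fun (p : nat) (h g : nat -> C -> C) (z : C) : R :=
  Re (z * sum_n_m (fun k : nat =>
            RtoC (Cmod z ^ (2 * (k - 1))) *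
            (C_derive (h (p - k + 1)%nat) z - C_derive (g (p - k + 1)%nat) z))
          1 p)%C.

Definition B_fun (p : nat) (h g : nat -> C -> C) (z : C) : R :=
  Im (z * sum_n_m (fun k : nat =>
            RtoC (Cmod z ^ (2 * (k - 1))) *
            (C_derive (h (p - k + 1)%nat) z + C_derive (g (p - k + 1)%nat) z))
          1 p)%C.

Definition L_fun (p : nat) (h g : nat -> C -> C) (z : C) : R :=
  sqrt (A_fun p h g z ^ 2 + B_fun p h g z ^ 2).

(* Main.v *)
Require Import Defs.
From Stdlib Require Import Reals Lra Lia Psatz Classical ClassicalEpsilon.
From Coquelicot Require Import Coquelicot.
Open Scope R_scope.

(** Let [W = - i * dPhi/dtheta]; the radial factors are constant on circles, so
    [Re W = A], [Im W = B] and the left-hand side of the inequality is [Re (W * conj Phi)].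
    If a point moves in the direction [d] in the image, its local preimage [z] satisfies
    [J * d|z|^2/dt = 2 Re (W * conj d)].  The inequality says that this is nonnegative for
    all [d] within the angle [alpha pi / 2] of [Phi z].  Hence segments running from the cone
    at a boundary point [q] towards [q] lift to paths staying in the disc, and the cone
    misses the image.  Conversely, accessibility of all [Phi (r D)] makes them starlike, which
    forces [Phi] to be injective; then [Phi z] is a boundary point of [Phi (|z| D)], and the
    cone there gives [Re (W * conj d) >= 0] for its two extreme directions [d]. *)

(** * Sequential compactness in the plane *)

(** Accessibility constrains only the image sets, while a positive Jacobian gives injectivity only
    locally. If [Phi] were not injective, [Phi z] could be an interior point of [Phi (|z| D)], and
    the cone condition would say nothing at [z]. This is why global injectivity has to come before
    the inequality can be read off. The opposite implication avoids the question: it lifts one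
    segment at a time, from one chosen preimage. The geometry is carried out for any map of the disc
    with continuous partials and positive Jacobian. The representation of [Phi] by analytic
    functions enters only when [A], [B] and the left-hand side are identified with expressions in
    [W]. Local inversion, path lifting and the choice of a critical pair of double points all follow
    one scheme: minimise a continuous function over a sequentially compact set of pairs, then
    contradict minimality by a small move. *)

Definition cvg (u : nat -> C) (l : C) : Prop :=
  is_lim_seq (fun n => Re (u n)) (Re l) /\ is_lim_seq (fun n => Im (u n)) (Im l).

Lemma Cmod_sqr (z : C) : Cmod z ^ 2 = Re z ^ 2 + Im z ^ 2.
Proof. unfold Cmod, Re, Im; rewrite pow2_sqrt; nra. Qed.

Lemma Re_le_Cmod (z : C) : Rabs (Re z) <= Cmod z.
Proof.
  generalize (Cmod_sqr z) (Cmod_ge_0 z); intros.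
  apply Rsqr_incr_0_var; trivial; rewrite <- Rsqr_abs; unfold Rsqr; nra.
Qed.

Lemma Im_le_Cmod (z : C) : Rabs (Im z) <= Cmod z.
Proof.
  generalize (Cmod_sqr z) (Cmod_ge_0 z); intros.
  apply Rsqr_incr_0_var; trivial; rewrite <- Rsqr_abs; unfold Rsqr; nra.
Qed.

Lemma Cmod_le_abs (z : C) : Cmod z <= Rabs (Re z) + Rabs (Im z).
Proof.
  generalize (Cmod_sqr z) (Cmod_ge_0 z) (Rabs_pos (Re z)) (Rabs_pos (Im z)); intros.
  apply Rsqr_incr_0_var; [ unfold Rsqr | lra ].
  generalize (pow2_abs (Re z)) (pow2_abs (Im z)); nra.
Qed.

Lemma cvg_iff (u : nat -> C) (l : C) :
  cvg u l <-> is_lim_seq (fun n => Cmod (u n - l)) 0.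
Proof.
  split.
  - intros [h1 h2].
    apply is_lim_seq_le_le with (u := fun _ => 0)
      (w := fun n => Rabs (Re (u n) - Re l) + Rabs (Im (u n) - Im l)).
    + intros n; split; [ apply Cmod_ge_0 | apply (Cmod_le_abs (u n - l)) ].
    + apply is_lim_seq_const.
    + replace (Finite 0) with (Finite (Rabs (Re l - Re l) + Rabs (Im l - Im l)))
        by (now rewrite !Rminus_diag, Rabs_R0, Rplus_0_r).
      apply is_lim_seq_plus'; apply (is_lim_seq_abs _ (Finite _));
        apply is_lim_seq_minus'; trivial; apply is_lim_seq_const.
  - intros h; split.
    + apply is_lim_seq_ext with (fun n => Re l + Re (u n - l)).
      { intros n; destruct (u n), l; simpl; ring. }
      replace (Finite (Re l)) with (Finite ((Re l) + 0)) by now rewrite Rplus_0_r.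
      apply is_lim_seq_plus'; [ apply is_lim_seq_const | ].
      apply is_lim_seq_abs_0, is_lim_seq_le_le
        with (u := fun _ => 0) (w := fun n => Cmod (u n - l)); trivial; [ | apply is_lim_seq_const ].
      intros n; split; [ apply Rabs_pos | apply Re_le_Cmod ].
    + apply is_lim_seq_ext with (fun n => Im l + Im (u n - l)).
      { intros n; destruct (u n), l; simpl; ring. }
      replace (Finite (Im l)) with (Finite ((Im l) + 0)) by now rewrite Rplus_0_r.
      apply is_lim_seq_plus'; [ apply is_lim_seq_const | ].
      apply is_lim_seq_abs_0, is_lim_seq_le_le
        with (u := fun _ => 0) (w := fun n => Cmod (u n - l)); trivial; [ | apply is_lim_seq_const ].
      intros n; split; [ apply Rabs_pos | apply Im_le_Cmod ].
Qed.

Lemma cvg_eps (u : nat -> C) (l : C) :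
  cvg u l <-> forall eps, 0 < eps ->
    exists n0, forall n, (n0 <= n)%nat -> Cmod (u n - l) < eps.
Proof.
  rewrite cvg_iff, <- is_lim_seq_spec; unfold is_lim_seq'; split.
  - intros h eps he; destruct (h (mkposreal eps he)) as [n0 hn]; exists n0.
    intros n hn'; specialize (hn n hn'); simpl in hn.
    rewrite Rminus_0_r, Rabs_pos_eq in hn; trivial; apply Cmod_ge_0.
  - intros h [eps he]; destruct (h eps he) as [n0 hn]; exists n0.
    intros n hn'; specialize (hn n hn'); simpl.
    rewrite Rminus_0_r, Rabs_pos_eq; trivial; apply Cmod_ge_0.
Qed.

Lemma is_lim_seq_sqr (x : nat -> R) (l : R) :
  is_lim_seq x l -> is_lim_seq (fun n => x n ^ 2) (l ^ 2).
Proof.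
  intros h; apply is_lim_seq_ext with (fun n => x n * x n); [ intros; ring | ].
  replace (l ^ 2) with (l * l) by ring; now apply is_lim_seq_mult'.
Qed.

Lemma cvg_Cmod (u : nat -> C) (l : C) :
  cvg u l -> is_lim_seq (fun n => Cmod (u n)) (Cmod l).
Proof.
  intros [h1 h2]; unfold Cmod.
  apply (is_lim_seq_continuous sqrt (fun n => fst (u n) ^ 2 + snd (u n) ^ 2)).
  - apply continuity_pt_sqrt; nra.
  - apply is_lim_seq_plus'; now apply is_lim_seq_sqr.
Qed.

Lemma cvg_unique (u : nat -> C) (l l' : C) : cvg u l -> cvg u l' -> l = l'.
Proof.
  intros [h1 h2] [h3 h4]; apply injective_projections.
  - apply is_lim_seq_unique in h1; apply is_lim_seq_unique in h3; unfold Re in *; congruence.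
  - apply is_lim_seq_unique in h2; apply is_lim_seq_unique in h4; unfold Im in *; congruence.
Qed.

Lemma cvg_minus (u v : nat -> C) (a b : C) :
  cvg u a -> cvg v b -> cvg (fun n => u n - v n)%C (a - b)%C.
Proof.
  intros [h1 h2] [h3 h4]; split; [ apply (is_lim_seq_minus' _ _ _ _ h1 h3)
    | apply (is_lim_seq_minus' _ _ _ _ h2 h4) ].
Qed.

Lemma cvg_const (a : C) : cvg (fun _ => a) a.
Proof. split; apply is_lim_seq_const. Qed.

Lemma cvg_subseq (u : nat -> C) (l : C) (phi : nat -> nat) :
  (forall n, (phi n < phi (S n))%nat) -> cvg u l -> cvg (fun n => u (phi n)) l.
Proof.
  intros hphi [h1 h2]; split;
    [ apply (is_lim_seq_subseq (fun n => Re (u n)))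
    | apply (is_lim_seq_subseq (fun n => Im (u n))) ]; trivial;
    now apply eventually_subseq.
Qed.

Lemma is_lim_seq_inv_INR : is_lim_seq (fun n => / INR (S n)) 0.
Proof.
  apply (is_lim_seq_incr_1 (fun n => / INR n)).
  replace (Finite 0) with (Rbar_inv p_infty) by reflexivity.
  apply is_lim_seq_inv; [ apply is_lim_seq_INR | discriminate ].
Qed.

(** [Bolzano_Weierstrass] yields a cluster value [l]. The subsequence is then chosen recursively:
    term [n] lies beyond the previous index and within [/ INR (S n)] of [l]. *)
Lemma bounded_subseq (x : nat -> R) (M : R) :
  (forall n, Rabs (x n) <= M) ->
  exists (phi : nat -> nat) (l : R),
    (forall n, (phi n < phi (S n))%nat) /\ is_lim_seq (fun n => x (phi n)) l.
Proof.
  intros hM.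
  destruct (Bolzano_Weierstrass x (fun c => - M <= c <= M)) as [l hl].
  { apply compact_P3. }
  { intros n; specialize (hM n); split; revert hM; unfold Rabs; destruct Rcase_abs; lra. }
  assert (hp : forall k N, exists p, (N <= p)%nat /\ Rabs (x p - l) < / INR (S k)).
  { intros k N.
    assert (hk : 0 < / INR (S k)) by (apply Rinv_0_lt_compat, lt_0_INR; lia).
    destruct (hl (disc l (mkposreal _ hk)) N) as [p [h1 h2]].
    - exists (mkposreal _ hk); intros y hy; exact hy.
    - now exists p. }
  pose (pick k N := proj1_sig (constructive_indefinite_description _ (hp k N))).
  assert (hpick : forall k N, (N <= pick k N)%nat /\ Rabs (x (pick k N) - l) < / INR (S k))
    by (intros k N; apply (proj2_sig (constructive_indefinite_description _ (hp k N)))).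
  pose (phi := fix phi n := match n with O => pick 0%nat 0%nat | S m => pick n (S (phi m)) end).
  exists phi, l; split.
  - intros n; simpl; destruct (hpick (S n) (S (phi n))); lia.
  - assert (hphi : forall n, Rabs (x (phi n) - l) < / INR (S n)).
    { intros [|n]; apply hpick. }
    apply is_lim_seq_ext with (fun n => l + (x (phi n) - l)); [ intros; ring | ].
    replace (Finite l) with (Finite (l + 0)) by now rewrite Rplus_0_r.
    apply is_lim_seq_plus'; [ apply is_lim_seq_const | ].
    apply is_lim_seq_abs_0.
    apply is_lim_seq_le_le with (u := fun _ => 0) (w := fun n => / INR (S n)).
    + intros n; split; [ apply Rabs_pos | left; apply hphi ].
    + apply is_lim_seq_const.
    + apply is_lim_seq_inv_INR.
Qed.

Lemma bounded_subseq_C (u : nat -> C) (M : R) :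
  (forall n, Cmod (u n) <= M) ->
  exists (phi : nat -> nat) (l : C),
    (forall n, (phi n < phi (S n))%nat) /\ cvg (fun n => u (phi n)) l.
Proof.
  intros hM.
  destruct (bounded_subseq (fun n => Re (u n)) M) as [f1 [l1 [h1 h1']]].
  { intros n; eapply Rle_trans; [ apply Re_le_Cmod | apply hM ]. }
  destruct (bounded_subseq (fun n => Im (u (f1 n))) M) as [f2 [l2 [h2 h2']]].
  { intros n; eapply Rle_trans; [ apply Im_le_Cmod | apply hM ]. }
  exists (fun n => f1 (f2 n)), (l1, l2); split.
  - assert (hmono : forall a b, (a < b)%nat -> (f1 a < f1 b)%nat).
    { intros a b hab; induction hab as [|b hab IH]; [ apply h1 | ].
      specialize (h1 b); lia. }
    intros n; apply hmono, h2.
  - split; trivial.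
    apply (is_lim_seq_subseq (fun n => Re (u (f1 n)))); trivial.
    now apply eventually_subseq.
Qed.

(** Relations between two points serve three minimisations at once: over single points (on the
    diagonal), over a point with a segment parameter, and over double points of a map. *)
Definition seq_closed (Q : C -> C -> Prop) : Prop :=
  forall (u v : nat -> C) (a b : C),
    (forall n, Q (u n) (v n)) -> cvg u a -> cvg v b -> Q a b.

Definition seq_continuous_on (Q : C -> C -> Prop) (g : C -> C -> R) : Prop :=
  forall (u v : nat -> C) (a b : C), (forall n, Q (u n) (v n)) -> Q a b ->
    cvg u a -> cvg v b -> is_lim_seq (fun n => g (u n) (v n)) (g a b).

Lemma min_attained (Q : C -> C -> Prop) (g : C -> C -> R) (M m : R) :
  (exists a b, Q a b) ->
  (forall a b, Q a b -> Cmod a <= M /\ Cmod b <= M) ->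
  (forall a b, Q a b -> m <= g a b) ->
  seq_closed Q -> seq_continuous_on Q g ->
  exists a b, Q a b /\ forall a' b', Q a' b' -> g a b <= g a' b'.
Proof.
  intros [a0 [b0 h0]] hM hm hcl hcont.
  (* The infimum of [g] is obtained as [- i], with [i] the supremum of [- g]. *)
  destruct (completeness (fun x => exists a b, Q a b /\ x = - g a b)) as [i [hi1 hi2]].
  { exists (- m); intros x [a [b [hab ->]]]; specialize (hm a b hab); lra. }
  { now exists (- g a0 b0), a0, b0. }
  assert (hpts : forall n : nat, exists p : C * C,
            Q (fst p) (snd p) /\ g (fst p) (snd p) < - i + / INR (S n)).
  { intros n; apply NNPP; intros hno.
    assert (hk : 0 < / INR (S n)) by (apply Rinv_0_lt_compat, lt_0_INR; lia).
    assert (i <= i - / INR (S n)); [ apply hi2 | lra ].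
    intros x [a [b [hab ->]]].
    apply Rnot_lt_le; intros hlt; apply hno; exists (a, b); cbn [fst snd]; split; trivial; lra. }
  pose (s n := proj1_sig (constructive_indefinite_description _ (hpts n))).
  assert (hs : forall n, Q (fst (s n)) (snd (s n)) /\
                         g (fst (s n)) (snd (s n)) < - i + / INR (S n))
    by (intros n; apply (proj2_sig (constructive_indefinite_description _ (hpts n)))).
  destruct (bounded_subseq_C (fun n => fst (s n)) M) as [f1 [a [h1 h1']]].
  { intros n; apply (hM _ _ (proj1 (hs n))). }
  destruct (bounded_subseq_C (fun n => snd (s (f1 n))) M) as [f2 [b [h2 h2']]].
  { intros n; apply (hM _ _ (proj1 (hs (f1 n)))). }
  apply (fun h => cvg_subseq _ _ f2 h h1') in h2 as h1''.
  assert (hQ : Q a b).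
  { apply (hcl _ _ a b (fun n => proj1 (hs (f1 (f2 n)))) h1'' h2'). }
  exists a, b; split; trivial.
  intros a' b' hab'.
  apply Rle_trans with (- i);
    [ | apply Ropp_le_cancel; rewrite Ropp_involutive; apply hi1; now exists a', b' ].
  (* Needed so that the error [/ INR (S (f1 (f2 n)))] along the subsequence is at most
     [/ INR (S n)]. *)
  assert (hge : forall n, (n <= f1 (f2 n))%nat).
  { assert (hmono : forall f : nat -> nat,
      (forall n, (f n < f (S n))%nat) -> forall n, (n <= f n)%nat).
    { intros f hf n; induction n as [|n IH]; [ lia | specialize (hf n); lia ]. }
    intros n; apply Nat.le_trans with (f2 n); now apply hmono. }
  change (Rbar_le (g a b) (- i)).
  apply is_lim_seq_le with (u := fun n => g (fst (s (f1 (f2 n)))) (snd (s (f1 (f2 n)))))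
                           (v := fun n => - i + / INR (S n)).
  - intros n; left; eapply Rlt_le_trans; [ apply hs | ].
    apply Rplus_le_compat_l, Rinv_le_contravar; [ apply lt_0_INR; lia | apply le_INR ].
    specialize (hge n); lia.
  - apply hcont; trivial; intros n; apply hs.
  - replace (Finite (- i)) with (Finite ((- i) + 0)) by now rewrite Rplus_0_r.
    apply is_lim_seq_plus'; [ apply is_lim_seq_const | ].
    apply is_lim_seq_inv_INR.
Qed.

(** * Differentiable maps with positive Jacobian *)

(** [inner v w] and [cross v w] are the real and imaginary parts of [Cconj v * w]. *)
Definition cross (v w : C) : R := Re v * Im w - Im v * Re w.

(** The real-linear map of the plane that sends [1] to [a] and [Ci] to [b]. *)
Definition dlin (a b u : C) : C :=
  (Re u * Re a + Im u * Re b, Re u * Im a + Im u * Im b).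

(** With [X], [Y] the partial derivatives of [f] at [z], this is
    [- i] times the derivative of [f] along the circle through [z]. *)
Definition angular (X Y : C -> C) (z : C) : C :=
  (Re z * Im (Y z) - Im z * Im (X z), Im z * Re (X z) - Re z * Re (Y z)).

Definition has_differential (f : C -> C) (z a b : C) : Prop :=
  forall eps, 0 < eps -> exists dl, 0 < dl /\ forall u, Cmod u < dl ->
    Cmod (f (z + u)%C - f z - dlin a b u)%C <= eps * Cmod u.

(** Continuity of the partials has a sequential form because it serves to pass to the limit along
    intermediate points of the mean value theorem. *)
Record immersion (f X Y : C -> C) : Prop := {
  imm_diff : forall z, Cmod z < 1 -> has_differential f z (X z) (Y z);
  imm_cvg_X : forall u z, Cmod z < 1 -> cvg u z -> cvg (fun n => X (u n)) (X z);
  imm_cvg_Y : forall u z, Cmod z < 1 -> cvg u z -> cvg (fun n => Y (u n)) (Y z);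
  imm_pos : forall z, Cmod z < 1 -> 0 < cross (X z) (Y z) }.

(** Lagrange's identity, that is, multiplicativity of the modulus for [Cconj v * w]. *)
Lemma inner_cross_sqr (v w : C) :
  inner v w ^ 2 + cross v w ^ 2 = Cmod v ^ 2 * Cmod w ^ 2.
Proof. rewrite !Cmod_sqr; unfold inner, cross; ring. Qed.

Lemma inner_abs_le (v w : C) : Rabs (inner v w) <= Cmod v * Cmod w.
Proof.
  generalize (inner_cross_sqr v w) (Cmod_ge_0 v) (Cmod_ge_0 w); intros h hv hw.
  apply Rsqr_incr_0_var; [ rewrite <- Rsqr_abs; unfold Rsqr; nra | now apply Rmult_le_pos ].
Qed.

Lemma cross_abs_le (v w : C) : Rabs (cross v w) <= Cmod v * Cmod w.
Proof.
  generalize (inner_cross_sqr v w) (Cmod_ge_0 v) (Cmod_ge_0 w); intros h hv hw.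
  apply Rsqr_incr_0_var; [ rewrite <- Rsqr_abs; unfold Rsqr; nra | now apply Rmult_le_pos ].
Qed.

Lemma inner_sub_r (v a b : C) : inner v (a - b) = inner v a - inner v b.
Proof. destruct v, a, b; unfold inner; cbn; ring. Qed.

Lemma inner_scal_r (v a : C) (s : R) : inner v (RtoC s * a) = s * inner v a.
Proof. destruct v, a; unfold inner; cbn; ring. Qed.

(** [angular] is normal to the image of the circle through [z], so pairing it with a transported
    velocity sees only the radial part of [u]. Since [2 * inner z u] is the derivative of [|z|^2],
    this identity converts motion in the image into change of modulus in the disc. *)
Lemma inner_angular (X Y : C -> C) (z u : C) :
  inner (angular X Y z) (dlin (X z) (Y z) u) = cross (X z) (Y z) * inner z u.
Proof. unfold angular, inner, cross, dlin; destruct u, (X z), (Y z), z; cbn; ring. Qed.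

Lemma Cmod_scal (s : R) (u : C) : 0 <= s -> Cmod (RtoC s * u) = s * Cmod u.
Proof. intros hs; rewrite Cmod_mult, Cmod_R, Rabs_pos_eq; trivial. Qed.

Lemma Cmod_sub_comm (a b : C) : Cmod (a - b) = Cmod (b - a).
Proof. rewrite <- Cmod_opp; f_equal; ring. Qed.

Lemma Cmod_sub_ge (a b : C) : Cmod a - Cmod b <= Cmod (a - b).
Proof.
  assert (h := Cmod_triangle (a - b) b); replace (a - b + b)%C with a in h by ring; lra.
Qed.

Lemma dlin_scal (a b u : C) (s : R) : dlin a b (RtoC s * u) = (RtoC s * dlin a b u)%C.
Proof. destruct a, b, u; unfold dlin; apply injective_projections; simpl; ring. Qed.

Lemma dlin_surj (a b v : C) : cross a b <> 0 -> exists u, dlin a b u = v.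
Proof.
  (* Cramer's rule. *)
  intros h; exists (cross v b / cross a b, cross a v / cross a b).
  destruct a as [a1 a2], b as [b1 b2], v as [v1 v2]; unfold dlin, cross in *; cbn in *.
  apply injective_projections; cbn; field; exact h.
Qed.

(** By Cramer's rule [cross a b] times each coordinate of [u] is a cross product of [dlin a b u]
    with [b] or with [a]; adding the two bounds gives the constant
    [cross a b / (Cmod a + Cmod b)]. *)
Lemma dlin_lower (a b : C) : 0 < cross a b ->
  exists c, 0 < c /\ forall u, c * Cmod u <= Cmod (dlin a b u).
Proof.
  intros h.
  assert (ha := Cmod_ge_0 a); assert (hb := Cmod_ge_0 b).
  assert (hab : 0 < Cmod a + Cmod b).
  { assert (h' := cross_abs_le a b); rewrite Rabs_pos_eq in h' by lra.
    destruct (Req_dec (Cmod a) 0) as [h0|]; [ rewrite h0 in h'; lra | lra ]. }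
  exists (cross a b / (Cmod a + Cmod b)); split; [ now apply Rdiv_lt_0_compat | ].
  intros u.
  apply Rmult_le_reg_r with (Cmod a + Cmod b); trivial.
  replace (cross a b / (Cmod a + Cmod b) * Cmod u * (Cmod a + Cmod b))
    with (cross a b * Cmod u) by (field; lra).
  assert (h1 := cross_abs_le (dlin a b u) b); assert (h2 := cross_abs_le a (dlin a b u)).
  replace (cross (dlin a b u) b) with (cross a b * Re u) in h1
    by (unfold cross, dlin; cbn; ring).
  replace (cross a (dlin a b u)) with (cross a b * Im u) in h2
    by (unfold cross, dlin; cbn; ring).
  rewrite Rabs_mult, (Rabs_pos_eq (cross a b)) in h1, h2 by lra.
  assert (h3 := Rmult_le_compat_l _ _ _ (Rlt_le _ _ h) (Cmod_le_abs u)); lra.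
Qed.

(** * Local inversion *)

Lemma immersion_cvg (f X Y : C -> C) (hf : immersion f X Y) (u : nat -> C) (z : C) :
  Cmod z < 1 -> cvg u z -> cvg (fun n => f (u n)) (f z).
Proof.
  intros hz hu; apply cvg_eps; intros eps he.
  destruct (imm_diff _ _ _ hf z hz 1 Rlt_0_1) as [dl [hdl hd]].
  pose (K := 1 + Cmod (X z) + Cmod (Y z)).
  assert (hX := Cmod_ge_0 (X z)); assert (hY := Cmod_ge_0 (Y z)).
  assert (hK : 0 < K) by (unfold K; lra).
  assert (hm : 0 < Rmin dl (eps / K)) by (apply Rmin_pos; trivial; now apply Rdiv_lt_0_compat).
  destruct (proj1 (cvg_eps u z) hu _ hm) as [n0 hn]; exists n0; intros n hn0.
  specialize (hn n hn0).
  assert (h1 := Rlt_le_trans _ _ _ hn (Rmin_l _ _)).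
  assert (h2 := Rlt_le_trans _ _ _ hn (Rmin_r _ _)).
  specialize (hd _ h1); replace (z + (u n - z))%C with (u n) in hd by ring.
  set (v := (u n - z)%C) in *.
  assert (hv : Cmod (dlin (X z) (Y z) v) <= (Cmod (X z) + Cmod (Y z)) * Cmod v).
  { replace (dlin (X z) (Y z) v) with (RtoC (Re v) * X z + RtoC (Im v) * Y z)%C
      by (unfold dlin; destruct (X z), (Y z), v; apply injective_projections; simpl; ring).
    eapply Rle_trans; [ apply Cmod_triangle | ]; rewrite !Cmod_mult, !Cmod_R.
    generalize (Re_le_Cmod v) (Im_le_Cmod v); nra. }
  assert (h3 := Cmod_sub_ge (f (u n) - f z) (dlin (X z) (Y z) v)).
  apply Rle_lt_trans with (K * Cmod v); [ unfold K; lra | ].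
  apply Rmult_lt_compat_l with (r := K) in h2; trivial.
  replace (K * (eps / K)) with eps in h2 by (field; lra); exact h2.
Qed.

(** A damped Newton step. The vector [u] solves the linearised equation, so moving by [s * u]
    multiplies the error [f a - w] by [1 - s], up to a remainder of at most half of the gain
    [s * e]. *)
Lemma immersion_descend (f X Y : C -> C) (hf : immersion f X Y) (a w : C) (eps : R) :
  Cmod a < 1 -> 0 < eps -> f a <> w ->
  exists a', Cmod (a' - a) < eps /\ Cmod (f a' - w) < Cmod (f a - w).
Proof.
  intros ha heps hne.
  destruct (dlin_surj (X a) (Y a) (w - f a)) as [u hu].
  { apply Rgt_not_eq, (imm_pos _ _ _ hf a ha). }
  assert (hu0 := Cmod_ge_0 u).
  assert (he : 0 < Cmod (f a - w)).
  { apply Cmod_gt_0; intros h; apply hne.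
    replace (f a) with (f a - w + w)%C by ring; rewrite h; ring. }
  set (e := Cmod (f a - w)) in *.
  pose (K := Cmod u + 1); assert (hK : 0 < K) by (unfold K; lra).
  destruct (imm_diff _ _ _ hf a ha (e / (2 * K))) as [dl [hdl hd]].
  { apply Rdiv_lt_0_compat; lra. }
  pose (s := Rmin (1 / 2) (Rmin dl eps / (2 * K))).
  assert (hm : 0 < Rmin dl eps) by now apply Rmin_pos.
  assert (hs : 0 < s) by (apply Rmin_pos; [ lra | apply Rdiv_lt_0_compat; lra ]).
  assert (hs1 : s <= 1 / 2) by apply Rmin_l.
  assert (hs2 : s * K < Rmin dl eps).
  { apply Rle_lt_trans with (Rmin dl eps / (2 * K) * K).
    - apply Rmult_le_compat_r; [ lra | apply Rmin_r ].
    - replace (Rmin dl eps / (2 * K) * K) with (Rmin dl eps / 2) by (field; lra); lra. }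
  assert (hsu : Cmod (RtoC s * u) < Rmin dl eps).
  { rewrite Cmod_scal by lra; unfold K in hs2; nra. }
  exists (a + RtoC s * u)%C; split.
  - replace (a + RtoC s * u - a)%C with (RtoC s * u)%C by ring.
    eapply Rlt_le_trans; [ apply hsu | apply Rmin_r ].
  - specialize (hd _ (Rlt_le_trans _ _ _ hsu (Rmin_l _ _))).
    rewrite dlin_scal, hu, (Cmod_scal s u) in hd by lra.
    set (r := (f (a + RtoC s * u)%C - f a - RtoC s * (w - f a))%C) in *.
    replace (f (a + RtoC s * u)%C - w)%C with (RtoC (1 - s) * (f a - w) + r)%C
      by (unfold r; rewrite RtoC_minus; ring).
    eapply Rle_lt_trans; [ apply Cmod_triangle | ].
    rewrite Cmod_scal by lra; fold e.
    assert (e / (2 * K) * (s * Cmod u) <= s * e / 2); [ | nra ].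
    replace (s * e / 2) with (e / (2 * K) * (s * K)) by (field; lra).
    apply Rmult_le_compat_l; [ left; apply Rdiv_lt_0_compat; lra | unfold K; nra ].
Qed.

(** The order of quantifiers matters: [c] is fixed before [eps], so the precision of the
    linearisation may be chosen in terms of [c]. Half of the lower bound of the differential absorbs
    the remainder. *)
Lemma immersion_lower (f X Y : C -> C) (hf : immersion f X Y) (z : C) :
  Cmod z < 1 -> exists c, 0 < c /\ forall eps, 0 < eps -> exists dl, 0 < dl /\
    forall u, Cmod u < dl ->
      c * Cmod u <= Cmod (f (z + u)%C - f z)%C /\
      Cmod (f (z + u)%C - f z - dlin (X z) (Y z) u)%C <= eps * Cmod u.
Proof.
  intros hz.
  destruct (dlin_lower (X z) (Y z) (imm_pos _ _ _ hf z hz)) as [c [hc hlow]].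
  exists (c / 2); split; [ lra | ]; intros eps heps.
  destruct (imm_diff _ _ _ hf z hz (Rmin eps (c / 2))) as [dl [hdl hd]].
  { apply Rmin_pos; lra. }
  exists dl; split; trivial; intros u hu; specialize (hd u hu); specialize (hlow u).
  assert (hu0 := Cmod_ge_0 u).
  assert (h1 := Rmin_l eps (c / 2)); assert (h2 := Rmin_r eps (c / 2)).
  split; [ | nra ].
  assert (h3 := Cmod_sub_ge (dlin (X z) (Y z) u) (f (z + u)%C - f z)).
  rewrite (Cmod_sub_comm (dlin _ _ _)) in h3; nra.
Qed.

(** To solve [f z' = w'] one minimises [|f z' - w'|] over a small closed disc about
    [z]: the minimum is interior, and there [immersion_descend] forces it to be [0]. *)
Lemma immersion_local_solve (f X Y : C -> C) (hf : immersion f X Y) (z : C) (eps : R) :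
  Cmod z < 1 -> 0 < eps -> exists dl, 0 < dl /\
  forall w, Cmod (w - f z) < dl -> exists z',
    Cmod z' < 1 /\ Cmod (z' - z) < eps /\ f z' = w /\
    Rabs (cross (X z) (Y z) * (Cmod z' ^ 2 - Cmod z ^ 2)
          - 2 * inner (angular X Y z) (w - f z)) <= eps * Cmod (w - f z).
Proof.
  intros hz heps.
  destruct (immersion_lower f X Y hf z hz) as [c [hc hlow]].
  set (W := angular X Y z); set (J := cross (X z) (Y z)).
  assert (hJ : 0 < J) by (apply (imm_pos _ _ _ hf z hz)).
  assert (hW := Cmod_ge_0 W).
  (* The final estimate has two errors, [2 * Cmod W * e1 * Cmod u] from the linearisation and
     [J * Cmod u ^ 2] from expanding the square. With [Cmod u <= e2], each is at most
     [eps * c * Cmod u / 2], and [c * Cmod u <= Cmod (w - f z)]. *)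
  pose (e1 := eps * c / (4 * (Cmod W + 1))).
  assert (he1 : 0 < e1) by (apply Rdiv_lt_0_compat; nra).
  assert (he1' : 2 * Cmod W * e1 <= eps * c / 2).
  { replace (eps * c / 2) with (2 * (Cmod W + 1) * e1) by (unfold e1; field; lra); nra. }
  destruct (hlow e1 he1) as [dl [hdl hd]].
  pose (e2 := eps * c / (2 * (J + 1))).
  assert (he2 : 0 < e2) by (apply Rdiv_lt_0_compat; nra).
  assert (he2' : J * e2 <= eps * c / 2).
  { replace (eps * c / 2) with ((J + 1) * e2) by (unfold e2; field; lra); nra. }
  assert (exists eta, 0 < eta /\ eta < dl /\ eta < eps /\ eta < 1 - Cmod z /\ eta <= e2)
    as [eta [h0 [h1 [h2 [h3 h4]]]]].
  { exists (Rmin (Rmin dl eps / 2) (Rmin ((1 - Cmod z) / 2) e2)).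
    assert (hm : 0 < Rmin dl eps) by now apply Rmin_pos.
    assert (hm1 := Rmin_l dl eps); assert (hm2 := Rmin_r dl eps).
    generalize (Rmin_l (Rmin dl eps / 2) (Rmin ((1 - Cmod z) / 2) e2))
      (Rmin_r (Rmin dl eps / 2) (Rmin ((1 - Cmod z) / 2) e2))
      (Rmin_l ((1 - Cmod z) / 2) e2) (Rmin_r ((1 - Cmod z) / 2) e2); intros.
    repeat split; try lra; repeat apply Rmin_pos; lra. }
  (* On the circle of radius [eta] about [z] the values of [f] are at least [c * eta] away from
     [f z], hence more than [c * eta / 2] away from [w]. There [|f a - w|] exceeds its value at the
     centre, so the minimiser is interior. *)
  exists (c * eta / 2); split; [ nra | ]; intros w hw.
  assert (hin : forall a, Cmod (a - z) <= eta -> Cmod a < 1).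
  { intros a ha; generalize (Cmod_sub_ge a z); lra. }
  destruct (min_attained (fun a b => Cmod (a - z) <= eta /\ b = a)
              (fun a _ => Cmod (f a - w)) 1 0) as [a [b [[ha _] hmin]]].
  - exists z, z; split; trivial; replace (z - z)%C with (RtoC 0) by ring; rewrite Cmod_0; lra.
  - intros a b [ha ->]; specialize (hin a ha); lra.
  - intros; apply Cmod_ge_0.
  - intros u v a b hQ hu hv; split.
    + change (Rbar_le (Cmod (a - z)) eta).
      apply is_lim_seq_le with (u := fun n => Cmod (u n - z)) (v := fun _ => eta);
        [ apply hQ | | apply is_lim_seq_const ].
      apply cvg_Cmod with (u := fun n => (u n - z)%C), cvg_minus; trivial; apply cvg_const.
    + apply (cvg_unique v); trivial.
      apply cvg_eps; intros e he; destruct (proj1 (cvg_eps u a) hu e he) as [n0 hn].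
      exists n0; intros n h; destruct (hQ n) as [_ ->]; now apply hn.
  - intros u v a b hQ [ha hb] hu hv.
    apply cvg_Cmod with (u := fun n => (f (u n) - w)%C), cvg_minus; [ | apply cvg_const ].
    apply (immersion_cvg f X Y hf); trivial; now apply hin.
  - destruct (hd (a - z)%C (Rle_lt_trans _ _ _ ha h1)) as [hda hdb].
    replace (z + (a - z))%C with a in hda, hdb by ring.
    assert (hfa : f a = w).
    { assert (hlt : Cmod (a - z) < eta).
      { destruct (Rle_lt_or_eq_dec _ _ ha) as [|heq]; trivial.
        rewrite heq in hda.
        assert (hz' : Cmod (f a - w) <= Cmod (f z - w)).
        { apply (hmin z z); split; trivial.
          replace (z - z)%C with (RtoC 0) by ring; rewrite Cmod_0; lra. }
        rewrite (Cmod_sub_comm (f z)) in hz'.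
        assert (ht := Cmod_triangle (f a - w) (w - f z)).
        replace (f a - w + (w - f z))%C with (f a - f z)%C in ht by ring; lra. }
      apply NNPP; intros hne.
      destruct (immersion_descend f X Y hf a w (eta - Cmod (a - z)) (hin a ha))
        as [a' [ha' hlt']]; trivial; [ lra | ].
      apply (Rlt_not_le _ _ hlt'), (hmin a' a'); split; trivial.
      assert (ht := Cmod_triangle (a' - a) (a - z)).
      replace (a' - a + (a - z))%C with (a' - z)%C in ht by ring; lra. }
    exists a; split; [ now apply hin | ]; split; [ lra | ]; split; trivial.
    rewrite hfa in *.
    set (u := (a - z)%C) in *; set (v := (w - f z)%C) in *.
    set (e := (v - dlin (X z) (Y z) u)%C) in *.
    assert (hu0 := Cmod_ge_0 u); assert (hv0 := Cmod_ge_0 v).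
    (* Here [e] is the linearisation error: [J * inner z u] equals [inner W (v - e)], and
       [Cmod a ^ 2 - Cmod z ^ 2] equals [2 * inner z u + Cmod u ^ 2]. *)
    replace (J * (Cmod a ^ 2 - Cmod z ^ 2) - 2 * inner W v)
      with (- 2 * inner W e + J * Cmod u ^ 2).
    2:{ assert (hWe : inner W e = inner W v - J * inner z u)
          by (unfold e; rewrite inner_sub_r; unfold W; now rewrite inner_angular).
        assert (ha2 : Cmod a ^ 2 = Cmod z ^ 2 + 2 * inner z u + Cmod u ^ 2).
        { unfold u; rewrite inner_sub_r, !Cmod_sqr; unfold inner.
          destruct a, z; cbn; ring. }
        rewrite hWe, ha2; ring. }
    assert (hi := inner_abs_le W e).
    eapply Rle_trans; [ apply Rabs_triang | ].
    rewrite !Rabs_mult, (Rabs_pos_eq J), (Rabs_pos_eq (Cmod u ^ 2)), Rabs_left by nra.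
    assert (Cmod W * Cmod e <= Cmod W * (e1 * Cmod u)) by (apply Rmult_le_compat_l; trivial).
    assert (J * Cmod u ^ 2 <= J * e2 * Cmod u).
    { replace (J * Cmod u ^ 2) with (J * Cmod u * Cmod u) by ring.
      apply Rmult_le_compat_r; trivial; apply Rmult_le_compat_l; lra. }
    assert (2 * (Cmod W * (e1 * Cmod u)) <= eps * c / 2 * Cmod u).
    { replace (2 * (Cmod W * (e1 * Cmod u))) with (2 * Cmod W * e1 * Cmod u) by ring.
      now apply Rmult_le_compat_r. }
    assert (J * e2 * Cmod u <= eps * c / 2 * Cmod u) by now apply Rmult_le_compat_r.
    assert (eps * (c * Cmod u) <= eps * Cmod v) by (apply Rmult_le_compat_l; lra).
    lra.
Qed.

(** Testing against a vector [k] makes [f] a real function of two real variables, to which the chain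
    rule and the mean value theorem apply. *)
Lemma differentiable_pt_lim_inner (f : C -> C) (k z a b : C) :
  has_differential f z a b ->
  differentiable_pt_lim (fun x y => inner k (f (x, y))) (Re z) (Im z)
    (inner k a) (inner k b).
Proof.
  intros hf [eps heps].
  assert (hk := Cmod_ge_0 k).
  destruct (hf (eps / (2 * (Cmod k + 1)))) as [dl [hdl hd]].
  { apply Rdiv_lt_0_compat; lra. }
  assert (hdl2 : 0 < dl / 2) by lra.
  exists (mkposreal _ hdl2); intros x y hx hy; simpl in hx, hy |- *.
  pose (u := ((x, y) - z)%C).
  assert (hu : Cmod u <= Rabs (x - Re z) + Rabs (y - Im z)) by apply (Cmod_le_abs u).
  specialize (hd u); replace (z + u)%C with (x, y) in hd
    by (unfold u; destruct z; apply injective_projections; simpl; ring).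
  assert (hd' := hd ltac:(lra)); clear hd.
  replace (inner k (f (x, y)) - inner k (f (Re z, Im z)) -
    (inner k a * (x - Re z) + inner k b * (y - Im z)))
    with (inner k (f (x, y) - f z - dlin a b u)).
  2:{ rewrite !inner_sub_r; unfold dlin, u, inner; destruct z; simpl; ring. }
  eapply Rle_trans; [ apply inner_abs_le | ].
  generalize (Rmax_l (Rabs (x - Re z)) (Rabs (y - Im z)))
    (Rmax_r (Rabs (x - Re z)) (Rabs (y - Im z))); intros h1 h2.
  set (m := Rmax _ _) in *.
  set (e := eps / (2 * (Cmod k + 1))) in *.
  assert (he : 0 < e) by (apply Rdiv_lt_0_compat; lra).
  replace (eps * m) with ((Cmod k + 1) * (e * (2 * m))) by (unfold e; field; lra).
  apply Rmult_le_compat; try apply Cmod_ge_0; [ lra | ].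
  eapply Rle_trans; [ apply hd' | apply Rmult_le_compat_l; lra ].
Qed.

Lemma is_derive_inner_comp (f : C -> C) (k v a b : C) (gamma : R -> C) (t : R) :
  has_differential f (gamma t) a b ->
  is_derive (fun s => Re (gamma s)) t (Re v) ->
  is_derive (fun s => Im (gamma s)) t (Im v) ->
  is_derive (fun s => inner k (f (gamma s))) t
    (inner k (dlin a b v)).
Proof.
  intros hf h1 h2; apply is_derive_Reals in h1, h2; apply is_derive_Reals.
  replace (inner k _) with
    (inner k a * Re v + inner k b * Im v)
    by (unfold inner, dlin; simpl; ring).
  assert (hc := derivable_pt_lim_comp_2d _ _ _ _ _ _ _ _
    (differentiable_pt_lim_inner f k (gamma t) a b hf) h1 h2).
  intros eps heps; destruct (hc eps heps) as [dl hdl]; exists dl; intros s hs hs'.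
  specialize (hdl s hs hs').
  replace (gamma (t + s)) with (Re (gamma (t + s)), Im (gamma (t + s)))
    by (now destruct (gamma (t + s))).
  replace (f (gamma t)) with (f (Re (gamma t), Im (gamma t)))
    by (now destruct (gamma t)).
  exact hdl.
Qed.

Lemma Cmod_segment_le (u v : C) (t M : R) :
  0 <= t <= 1 -> Cmod u <= M -> Cmod v <= M -> Cmod (u + RtoC t * (v - u)) <= M.
Proof.
  intros ht hu hv.
  replace (u + RtoC t * (v - u))%C with (RtoC (1 - t) * u + RtoC t * v)%C
    by (rewrite RtoC_minus; ring).
  eapply Rle_trans; [ apply Cmod_triangle | ].
  rewrite !Cmod_scal by lra; nra.
Qed.

(** The mean value theorem fails for plane-valued maps; it holds for each fixed [k], at the price of
    an intermediate point that depends on [k]. *)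
Lemma immersion_mvt (f X Y : C -> C) (hf : immersion f X Y) (k u v : C) :
  Cmod u < 1 -> Cmod v < 1 -> exists t, 0 <= t <= 1 /\
    inner k (f v) - inner k (f u) =
    inner k (dlin (X (u + RtoC t * (v - u))%C) (Y (u + RtoC t * (v - u))%C) (v - u)).
Proof.
  intros hu hv.
  pose (gamma t := (u + RtoC t * (v - u))%C).
  assert (hg : forall t, 0 <= t <= 1 -> Cmod (gamma t) < 1).
  { intros t ht; apply Rle_lt_trans with (Rmax (Cmod u) (Cmod v)).
    - apply Cmod_segment_le; trivial; [ apply Rmax_l | apply Rmax_r ].
    - now apply Rmax_lub_lt. }
  assert (hd : forall t, 0 <= t <= 1 -> is_derive (fun s => inner k (f (gamma s))) t
      (inner k (dlin (X (gamma t)) (Y (gamma t)) (v - u)))).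
  { intros t ht; apply is_derive_inner_comp; [ now apply (imm_diff _ _ _ hf), hg | | ];
      unfold gamma; destruct u, v; simpl; auto_derive; trivial; ring. }
  destruct (MVT_gen (fun s => inner k (f (gamma s))) 0 1
    (fun t => inner k (dlin (X (gamma t)) (Y (gamma t)) (v - u)))) as [t [ht heq]].
  - intros t ht; rewrite Rmin_left, Rmax_right in ht by lra; apply hd; lra.
  - intros t ht; rewrite Rmin_left, Rmax_right in ht by lra.
    apply derivable_continuous_pt; eexists; apply is_derive_Reals, hd; lra.
  - rewrite Rmin_left, Rmax_right in ht by lra.
    exists t; split; trivial.
    replace (gamma 1) with v in heq by (unfold gamma; ring).
    replace (gamma 0) with u in heq by (unfold gamma; ring).
    rewrite heq; unfold gamma; ring.
Qed.

Lemma cvg_lt (u : nat -> C) (a : C) (M : R) :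
  cvg u a -> Cmod a < M -> exists n0, forall n, (n0 <= n)%nat -> Cmod (u n) < M.
Proof.
  intros hu ha; destruct (proj1 (cvg_eps u a) hu (M - Cmod a)) as [n0 hn]; [ lra | ].
  exists n0; intros n h; specialize (hn n h); generalize (Cmod_sub_ge (u n) a); lra.
Qed.

(** The mean value theorem for real and imaginary parts annihilates a mixed Jacobian
    [Re X(xi) Im Y(eta) - Re Y(xi) Im X(eta)], whose limit is the positive Jacobian. *)
Lemma immersion_locally_injective (f X Y : C -> C) (hf : immersion f X Y)
  (u v : nat -> C) (a : C) :
  Cmod a < 1 -> cvg u a -> cvg v a ->
  (forall n, f (u n) = f (v n)) -> (forall n, u n <> v n) -> False.
Proof.
  intros ha hu hv heq hne.
  destruct (cvg_lt u a 1 hu ha) as [n1 hn1]; destruct (cvg_lt v a 1 hv ha) as [n2 hn2].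
  assert (hpt : forall k : C, exists xi : nat -> C, cvg xi a /\
    forall n, (n1 + n2 <= n)%nat ->
      inner k (dlin (X (xi n)) (Y (xi n)) (v n - u n)) = 0).
  { intros k.
    assert (hex : forall n, exists t, 0 <= t <= 1 /\ ((n1 + n2 <= n)%nat ->
      inner k (dlin (X (u n + RtoC t * (v n - u n))%C)
        (Y (u n + RtoC t * (v n - u n))%C) (v n - u n)) = 0)).
    { intros n; destruct (Compare_dec.le_lt_dec (n1 + n2) n) as [hn|hn].
      - destruct (immersion_mvt f X Y hf k (u n) (v n)) as [t [ht h]].
        + apply hn1; lia.
        + apply hn2; lia.
        + exists t; split; trivial; intros _; rewrite <- h, heq; ring.
      (* A default value for the finitely many indices at which a point may still lie outside the
         disc. *)
      - exists 0; split; [ lra | intros; lia ]. }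
    pose (t n := proj1_sig (constructive_indefinite_description _ (hex n))).
    assert (ht := fun n => proj2_sig (constructive_indefinite_description _ (hex n))).
    fold t in ht; change (forall n, 0 <= t n <= 1 /\ ((n1 + n2 <= n)%nat ->
      inner k (dlin (X (u n + RtoC (t n) * (v n - u n))%C)
        (Y (u n + RtoC (t n) * (v n - u n))%C) (v n - u n)) = 0)) in ht.
    exists (fun n => u n + RtoC (t n) * (v n - u n))%C; split; [ | intros n; apply ht ].
    apply cvg_eps; intros eps he.
    destruct (proj1 (cvg_eps _ _) hu eps he) as [m1 hm1].
    destruct (proj1 (cvg_eps _ _) hv eps he) as [m2 hm2].
    exists (m1 + m2)%nat; intros n hn.
    replace (u n + RtoC (t n) * (v n - u n) - a)%C
      with ((u n - a) + RtoC (t n) * ((v n - a) - (u n - a)))%C by ring.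
    apply Rle_lt_trans with (Rmax (Cmod (u n - a)) (Cmod (v n - a))).
    - apply Cmod_segment_le; [ apply ht | apply Rmax_l | apply Rmax_r ].
    - apply Rmax_lub_lt; [ apply hm1 | apply hm2 ]; lia. }
  destruct (hpt (RtoC 1)) as [xi [hxi hxi0]]; destruct (hpt Ci) as [eta [heta heta0]].
  assert (hpos := imm_pos _ _ _ hf a ha).
  assert (hlim : is_lim_seq (fun n => Re (X (xi n)) * Im (Y (eta n))
                                      - Im (X (eta n)) * Re (Y (xi n))) (cross (X a) (Y a))).
  { apply is_lim_seq_minus'; apply is_lim_seq_mult';
      first [ apply (imm_cvg_X _ _ _ hf xi a ha hxi) | apply (imm_cvg_Y _ _ _ hf xi a ha hxi)
            | apply (imm_cvg_X _ _ _ hf eta a ha heta)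
            | apply (imm_cvg_Y _ _ _ hf eta a ha heta) ]. }
  assert (hlim0 : is_lim_seq (fun n => Re (X (xi n)) * Im (Y (eta n))
                                      - Im (X (eta n)) * Re (Y (xi n))) 0).
  { apply is_lim_seq_ext_loc with (fun _ => 0); [ | apply is_lim_seq_const ].
    exists (n1 + n2)%nat; intros n hn.
    specialize (hxi0 n hn); specialize (heta0 n hn); specialize (hne n).
    unfold inner, dlin in hxi0, heta0; simpl in hxi0, heta0.
    set (p := fst (X (xi n))) in *; set (q := fst (Y (xi n))) in *.
    unfold Re, Im.
    fold p q; set (r := snd (X (eta n))) in *; set (s := snd (Y (eta n))) in *.
    (* The nonzero vector [(d1, d2)] is killed by the matrix with rows [(p, q)] and [(r, s)], so its
       determinant vanishes. *)
    set (d1 := fst (v n) + - fst (u n)) in *; set (d2 := snd (v n) + - snd (u n)) in *.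
    assert (e1 : d1 * p + d2 * q = 0) by (unfold d1, d2, p, q, Re, Im in *; lra).
    assert (e2 : d1 * r + d2 * s = 0) by (unfold d1, d2, r, s, Re, Im in *; lra).
    assert (e3 : d1 * (p * s - r * q) = 0)
      by (replace (d1 * (p * s - r * q)) with
            (s * (d1 * p + d2 * q) - q * (d1 * r + d2 * s)) by ring; rewrite e1, e2; ring).
    assert (e4 : d2 * (p * s - r * q) = 0)
      by (replace (d2 * (p * s - r * q)) with
            (p * (d1 * r + d2 * s) - r * (d1 * p + d2 * q)) by ring; rewrite e1, e2; ring).
    apply Rmult_integral in e3; apply Rmult_integral in e4.
    destruct e3 as [e3|e3]; [ | now rewrite e3 ]; destruct e4 as [e4|e4]; [ | now rewrite e4 ].
    destruct hne; apply injective_projections; unfold d1, d2 in *; lra. }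
  apply is_lim_seq_unique in hlim; apply is_lim_seq_unique in hlim0.
  rewrite hlim in hlim0; injection hlim0; lra.
Qed.

(** Pairing [angular] with the image of the radial direction [z] gives the Jacobian times
    [Cmod z ^ 2]. *)
Lemma angular_neq_0 (f X Y : C -> C) (hf : immersion f X Y) (z : C) :
  Cmod z < 1 -> z <> RtoC 0 -> 0 < Cmod (angular X Y z).
Proof.
  intros hz h0; apply Cmod_gt_0; intros hW.
  assert (h := inner_angular X Y z z); rewrite hW in h.
  assert (hpos := imm_pos _ _ _ hf z hz).
  replace (inner z z) with (Cmod z ^ 2) in h by (rewrite Cmod_sqr; unfold inner; ring).
  replace (inner (RtoC 0) _) with 0 in h by (unfold inner; simpl; ring).
  apply Cmod_gt_0 in h0; assert (0 < Cmod z ^ 2) by now apply pow_lt.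
  assert (0 < cross (X z) (Y z) * Cmod z ^ 2) by now apply Rmult_lt_0_compat.
  lra.
Qed.

(** Along the lift of a ray in direction [d] one has
    [J * d|z|^2/dt = 2 * inner (angular X Y z) d]. *)
Lemma immersion_enter (f X Y : C -> C) (hf : immersion f X Y) (z d : C) (eps : R) :
  Cmod z < 1 -> 0 < eps -> inner (angular X Y z) d < 0 ->
  exists eta0, 0 < eta0 /\ forall eta, 0 < eta < eta0 -> exists z',
    Cmod z' < Cmod z /\ Cmod (z' - z) < eps /\ f z' = (f z + RtoC eta * d)%C.
Proof.
  intros hz heps hin.
  assert (hd := Cmod_ge_0 d).
  set (i := inner (angular X Y z) d) in *.
  (* With this tolerance the error is at most [- i * eta], half the size of the main term
     [2 * i * eta], so the sign of the latter prevails. *)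
  assert (he : 0 < Rmin eps (- i / (Cmod d + 1))).
  { apply Rmin_pos; trivial; apply Rdiv_lt_0_compat; lra. }
  destruct (immersion_local_solve f X Y hf z _ hz he) as [dl [hdl hs]].
  assert (he1 := Rmin_l eps (- i / (Cmod d + 1))).
  assert (he2 := Rmin_r eps (- i / (Cmod d + 1))).
  set (e := Rmin _ _) in *.
  exists (dl / (Cmod d + 1)); split; [ apply Rdiv_lt_0_compat; lra | ].
  intros eta [h0 h1].
  assert (hv : (f z + RtoC eta * d - f z = RtoC eta * d)%C) by ring.
  destruct (hs (f z + RtoC eta * d)%C) as [z' [hz' [hzz [hfz hN]]]].
  { rewrite hv, Cmod_scal by lra.
    assert (eta * (Cmod d + 1) < dl); [ | nra ].
    apply Rmult_lt_compat_r with (r := Cmod d + 1) in h1; [ | lra ].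
    replace (dl / (Cmod d + 1) * (Cmod d + 1)) with dl in h1 by (field; lra); exact h1. }
  exists z'; split; [ | split; trivial; lra ].
  rewrite hv, inner_scal_r, Cmod_scal in hN by lra; fold i in hN.
  apply Rabs_le_between in hN; destruct hN as [_ hN].
  assert (hed : e * (Cmod d + 1) <= - i).
  { replace (- i) with (- i / (Cmod d + 1) * (Cmod d + 1)) by (field; lra).
    apply Rmult_le_compat_r; lra. }
  assert (hneg : cross (X z) (Y z) * (Cmod z' ^ 2 - Cmod z ^ 2) < 0).
  { assert (e * (eta * Cmod d) <= eta * - i); [ | nra ].
    replace (e * (eta * Cmod d)) with (eta * (e * Cmod d)) by ring.
    apply Rmult_le_compat_l; lra. }
  assert (hpos := imm_pos _ _ _ hf z hz).
  apply Rnot_le_lt; intros hle.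
  assert (Cmod z ^ 2 <= Cmod z' ^ 2) by (apply pow_incr; split; [ apply Cmod_ge_0 | trivial ]).
  nra.
Qed.

Lemma immersion_image_nbhd (f X Y : C -> C) (hf : immersion f X Y) (r : R) (w : C) :
  r <= 1 -> image f (disk r) w ->
  exists dl, 0 < dl /\ forall w', Cmod (w' - w) < dl -> image f (disk r) w'.
Proof.
  intros hr [z [hz <-]]; unfold disk in hz.
  destruct (immersion_local_solve f X Y hf z (r - Cmod z)) as [dl [hdl hs]]; try lra.
  exists dl; split; trivial; intros w' hw'.
  destruct (hs w' hw') as [z' [_ [hz' [hf' _]]]].
  exists z'; split; trivial; unfold disk; generalize (Cmod_sub_ge z' z); lra.
Qed.

(** The lift of the segment from [f z0] to [q] cannot leave the disc when [|z|] does not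
    increase along it; the slack [eps] replaces an integral curve by a minimisation. *)
Lemma immersion_segment_lift (f X Y : C -> C) (hf : immersion f X Y) (r : R) (z0 q d : C) :
  r <= 1 -> Cmod z0 < r -> f z0 = (q + d)%C ->
  (forall z s, Cmod z < r -> 0 <= s <= 1 -> f z = (q + RtoC s * d)%C ->
     0 <= inner (angular X Y z) d) ->
  image f (disk r) q.
Proof.
  intros hr hz0 hq hmono.
  assert (h00 := Cmod_ge_0 z0); assert (hd0 := Cmod_ge_0 d).
  pose (eps := (r ^ 2 - Cmod z0 ^ 2) / 2).
  assert (heps : 0 < eps) by (unfold eps; nra).
  pose (Q a b := Im b = 0 /\ 0 <= Re b <= 1 /\ f a = (q + b * d)%C /\
                 Cmod a ^ 2 <= Cmod z0 ^ 2 + eps * (1 - Re b)).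
  assert (hsmall : forall a x, 0 <= x -> Cmod a ^ 2 <= Cmod z0 ^ 2 + eps * (1 - x) -> Cmod a < r).
  { intros a x hx ha; apply Rnot_le_lt; intros hle; unfold eps in *.
    assert (r ^ 2 <= Cmod a ^ 2) by (apply pow_incr; lra); nra. }
  destruct (min_attained Q (fun _ b => Re b) 1 0) as [a [b [[hb0 [hb1 [hfa hNa]]] hmin]]].
  - exists z0, (RtoC 1); repeat split; simpl; try lra; rewrite hq; ring.
  - intros a b [h1 [h2 [h3 h4]]]; split; [ apply hsmall in h4; lra | ].
    replace b with (RtoC (Re b)) by (destruct b; unfold RtoC; simpl in *; now rewrite h1).
    rewrite Cmod_R, Rabs_pos_eq; lra.
  - intros a b [h1 [h2 _]]; lra.
  - intros u v a b hQ hu hv.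
    assert (hb0 : Im b = 0).
    { assert (h := proj2 hv); apply is_lim_seq_unique in h.
      rewrite (Lim_seq_ext _ (fun _ => 0)), Lim_seq_const in h by (intros n; apply hQ).
      now injection h. }
    assert (hb1 : 0 <= Re b <= 1).
    { split.
      - apply (is_lim_seq_le (fun _ => 0) (fun n => Re (v n)) 0 (Re b));
          [ apply hQ | apply is_lim_seq_const | apply hv ].
      - apply (is_lim_seq_le (fun n => Re (v n)) (fun _ => 1) (Re b) 1);
          [ apply hQ | apply hv | apply is_lim_seq_const ]. }
    assert (hN : Cmod a ^ 2 <= Cmod z0 ^ 2 + eps * (1 - Re b)).
    { apply (is_lim_seq_le (fun n => Cmod (u n) ^ 2)
        (fun n => Cmod z0 ^ 2 + eps * (1 - Re (v n))) (Cmod a ^ 2)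
        (Cmod z0 ^ 2 + eps * (1 - Re b))); [ apply hQ | | ].
      - now apply is_lim_seq_sqr, cvg_Cmod.
      - apply is_lim_seq_plus'; [ apply is_lim_seq_const | ].
        apply is_lim_seq_mult'; [ apply is_lim_seq_const | ].
        apply is_lim_seq_minus'; [ apply is_lim_seq_const | apply hv ]. }
    repeat split; trivial; try apply hb1.
    apply (cvg_unique (fun n => f (u n))).
    + apply (immersion_cvg f X Y hf); trivial; apply hsmall in hN; lra.
    + destruct hv as [hv1 hv2]; split.
      * apply is_lim_seq_ext with (fun n => Re q + (Re (v n) * Re d - Im (v n) * Im d)).
        { intros n; destruct (hQ n) as [_ [_ [-> _]]]; reflexivity. }
        apply is_lim_seq_plus'; [ apply is_lim_seq_const | ].
        apply is_lim_seq_minus'; apply is_lim_seq_mult'; trivial; apply is_lim_seq_const.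
      * apply is_lim_seq_ext with (fun n => Im q + (Re (v n) * Im d + Im (v n) * Re d)).
        { intros n; destruct (hQ n) as [_ [_ [-> _]]]; reflexivity. }
        apply is_lim_seq_plus'; [ apply is_lim_seq_const | ].
        apply is_lim_seq_plus'; apply is_lim_seq_mult'; trivial; apply is_lim_seq_const.
  - intros u v a b _ _ _ hv; apply hv.
  - assert (har : Cmod a < r) by (apply hsmall in hNa; lra).
    replace b with (RtoC (Re b)) in * by (destruct b; unfold RtoC; simpl in *; now rewrite hb0).
    simpl in hb1, hNa, hmin; set (s := fst b) in *; change (Re b) with s in *.
    destruct (Rle_lt_or_eq_dec 0 s) as [hs|hs]; [ lra | | ].
    2:{ exists a; split; trivial; rewrite hfa, <- hs; ring. }
    exfalso.
    assert (hJ := imm_pos _ _ _ hf a ltac:(lra)); set (J := cross _ _) in *.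
    (* A further step of length [eta] costs an error of at most [eps * J * eta], which the slack
       exactly permits, while the main term [- 2 * eta * inner (angular X Y a) d] does not increase
       the modulus. Hence a positive parameter is never minimal. *)
    pose (e := eps * J / (Cmod d + 1)).
    assert (he : 0 < e) by (apply Rdiv_lt_0_compat; nra).
    destruct (immersion_local_solve f X Y hf a e) as [dl [hdl hsol]]; [ lra | trivial | ].
    pose (eta := Rmin s (dl / (Cmod d + 1) / 2)).
    assert (hdd : 0 < dl / (Cmod d + 1)) by (apply Rdiv_lt_0_compat; lra).
    assert (heta : 0 < eta) by (apply Rmin_pos; lra).
    assert (heta1 : eta <= s) by apply Rmin_l.
    assert (heta2 : eta * (Cmod d + 1) < dl).
    { assert (h := Rmin_r s (dl / (Cmod d + 1) / 2)); fold eta in h.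
      replace dl with (dl / (Cmod d + 1) * (Cmod d + 1)) by (field; lra).
      apply Rmult_lt_compat_r; lra. }
    assert (hv : (q + RtoC (s - eta) * d - f a = - (RtoC eta * d))%C)
      by (rewrite hfa, RtoC_minus; ring).
    destruct (hsol (q + RtoC (s - eta) * d)%C) as [a' [ha'1 [_ [hfa' hNa']]]].
    { rewrite hv, Cmod_opp, Cmod_scal by lra; nra. }
    assert (hi := hmono a s har hb1 hfa).
    rewrite hv, Cmod_opp, Cmod_scal in hNa' by lra.
    replace (inner (angular X Y a) (- (RtoC eta * d))) with (- (eta * inner (angular X Y a) d))
      in hNa' by (rewrite <- inner_scal_r; unfold inner; simpl; ring).
    apply Rabs_le_between in hNa'; destruct hNa' as [_ hNa']; fold J in hNa'.
    assert (hle : Cmod a' ^ 2 <= Cmod a ^ 2 + eps * eta).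
    { apply Rmult_le_reg_l with J; trivial.
      assert (e * (eta * Cmod d) <= eps * J * eta).
      { replace (eps * J * eta) with (e * (eta * (Cmod d + 1))) by (unfold e; field; lra).
        apply Rmult_le_compat_l; nra. }
      assert (0 <= eta * inner (angular X Y a) d) by (apply Rmult_le_pos; lra).
      lra. }
    specialize (hmin a' (RtoC (s - eta))); simpl in hmin.
    assert (hQ : Q a' (RtoC (s - eta))); [ | specialize (hmin hQ); lra ].
    repeat split; simpl; try lra; trivial.
Qed.

(** * Accessible images *)

Lemma locally_C_iff (z : C) (P : C -> Prop) :
  locally (T := C_UniformSpace) z P <->
  exists dl, 0 < dl /\ forall w, Cmod (w - z) < dl -> P w.
Proof.
  split.
  - intros [[e he] h]; exists e; split; trivial; intros w hw; apply h.
    split; eapply Rle_lt_trans; try exact hw;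
      [ apply (Re_le_Cmod (w - z)) | apply (Im_le_Cmod (w - z)) ].
  - intros [e [he h]]; assert (he2 : 0 < e / 2) by lra.
    exists (mkposreal _ he2); intros w [h1 h2]; apply h.
    eapply Rle_lt_trans; [ apply Cmod_le_abs | ].
    replace e with (e / 2 + e / 2) by field; now apply Rplus_lt_compat.
Qed.

(** Connectedness is tested along radii. If [f 0] is in [U] and [f z] in [V], the supremum of the
    parameters mapped into [U] can lie in neither open set; exchanging [U] and [V] settles the case
    of [f 0] in [V]. *)
Lemma immersion_connected_image (f X Y : C -> C) (hf : immersion f X Y) (r : R) :
  r <= 1 -> connected_set (image f (disk r)).
Proof.
  assert (main : forall U V : C -> Prop, r <= 1 -> open (T := C_UniformSpace) U ->
    open (T := C_UniformSpace) V -> (forall w, image f (disk r) w -> U w \/ V w) ->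
    (forall w, image f (disk r) w -> U w -> ~ V w) ->
    forall z, Cmod z < r -> U (f (RtoC 0)) -> V (f z) -> False).
  { intros U V hr hU hV hUV hdis z hz hU0 hVz.
    assert (h0 := Cmod_ge_0 z).
    assert (hdisk : forall t, 0 <= t <= 1 -> Cmod (RtoC t * z) < r).
    { intros t ht; rewrite Cmod_scal by lra; nra. }
    assert (himg : forall t, 0 <= t <= 1 -> image f (disk r) (f (RtoC t * z)%C)).
    { intros t ht; exists (RtoC t * z)%C; split; trivial; now apply hdisk. }
    assert (hnear : forall P : C -> Prop, open (T := C_UniformSpace) P ->
      forall t, 0 <= t <= 1 -> P (f (RtoC t * z)%C) ->
      exists e, 0 < e /\ forall s, Rabs (s - t) < e -> P (f (RtoC s * z)%C)).
    { intros P hP t ht hPt.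
      destruct (proj1 (locally_C_iff _ _) (hP _ hPt)) as [dl [hdl hd]].
      (* Continuity of [f] is at hand in sequential form, so failure for every radius is turned into
         a sequence of parameters tending to [t]. *)
      apply NNPP; intros hno.
      assert (hs : forall n : nat, exists s, Rabs (s - t) < / INR (S n) /\ ~ P (f (RtoC s * z)%C)).
      { intros n; apply NNPP; intros hn; apply hno; exists (/ INR (S n)); split.
        - apply Rinv_0_lt_compat, lt_0_INR; lia.
        - intros s hs; apply NNPP; intros hPs; apply hn; now exists s. }
      pose (s n := proj1_sig (constructive_indefinite_description _ (hs n))).
      assert (hsn := fun n => proj2_sig (constructive_indefinite_description _ (hs n))).
      assert (hc : cvg (fun n => RtoC (s n) * z)%C (RtoC t * z)%C).
      { apply cvg_iff.
        apply is_lim_seq_le_le with (u := fun _ => 0) (w := fun n => / INR (S n) * Cmod z).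
        - intros n; split; [ apply Cmod_ge_0 | ].
          replace (RtoC (s n) * z - RtoC t * z)%C with (RtoC (s n - t) * z)%C
            by (rewrite RtoC_minus; ring).
          rewrite Cmod_mult, Cmod_R; apply Rmult_le_compat_r; trivial; left; apply (hsn n).
        - apply is_lim_seq_const.
        - replace (Finite 0) with (Finite (0 * Cmod z)) by (now rewrite Rmult_0_l).
          apply is_lim_seq_mult'; [ | apply is_lim_seq_const ].
          apply is_lim_seq_inv_INR. }
      apply (immersion_cvg f X Y hf) in hc; [ | specialize (hdisk t ht); lra ].
      destruct (proj1 (cvg_eps _ _) hc dl hdl) as [n0 hn0].
      apply (proj2 (hsn n0)), hd, (hn0 n0); lia. }
    destruct (completeness (fun t => 0 <= t <= 1 /\ U (f (RtoC t * z)%C))) as [m [hm1 hm2]].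
    { exists 1; intros t [ht _]; lra. }
    { exists 0; split; [ lra | ]; now rewrite Cmult_0_l. }
    assert (hm : 0 <= m <= 1).
    { split; [ apply hm1; split; [ lra | now rewrite Cmult_0_l ]
             | apply hm2; intros t [ht _]; lra ]. }
    destruct (hUV _ (himg m hm)) as [hUm|hVm].
    - destruct (hnear U hU m hm hUm) as [e [he hs]].
      destruct (Req_dec m 1) as [->|hm3].
      + rewrite Cmult_1_l in hUm; apply (hdis (f z)); trivial; exists z; now split.
      + pose (t := Rmin 1 (m + e / 2)).
        assert (ht1 : t <= 1) by apply Rmin_l; assert (ht2 : t <= m + e / 2) by apply Rmin_r.
        assert (ht3 : m < t) by (apply Rmin_glb_lt; lra).
        apply (Rlt_not_le _ _ ht3), hm1; split; [ lra | ]; apply hs.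
        rewrite Rabs_pos_eq; lra.
    - destruct (hnear V hV m hm hVm) as [e [he hs]].
      assert (hle : m <= m - e); [ | lra ].
      apply hm2; intros t [ht hUt]; apply Rnot_lt_le; intros hlt.
      assert (htm : t <= m) by now apply hm1.
      apply (hdis _ (himg t ht) hUt), hs; rewrite Rabs_left1; lra. }
  intros hr U V hU hV hUV [a [[za [hza <-]] hUa]] [b [[zb [hzb <-]] hVb]].
  apply NNPP; intros hno.
  assert (hdis : forall w, image f (disk r) w -> U w -> ~ V w).
  { intros w hw hUw hVw; apply hno; now exists w. }
  assert (h0 : image f (disk r) (f (RtoC 0))).
  { exists (RtoC 0); split; trivial; unfold disk in *; rewrite Cmod_0.
    generalize (Cmod_ge_0 za); lra. }
  destruct (hUV _ h0) as [hU0|hV0].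
  - now apply (main U V hr hU hV hUV hdis zb).
  - apply (main V U hr hV hU) with za; trivial.
    + intros w hw; destruct (hUV w hw); tauto.
    + intros w hw h1 h2; now apply (hdis w hw).
Qed.

Lemma immersion_domain_image (f X Y : C -> C) (hf : immersion f X Y) (r : R) :
  0 < r <= 1 -> Defs.domain (image f (disk r)).
Proof.
  intros hr; split; [ | split ].
  - intros w hw; apply locally_C_iff, (immersion_image_nbhd f X Y hf); trivial; lra.
  - exists (f (RtoC 0)), (RtoC 0); split; trivial; unfold disk; rewrite Cmod_0; lra.
  - apply (immersion_connected_image f X Y hf); lra.
Qed.

(** * Cones and angles *)

Lemma cone_plus_0 (q : C) (alpha r : R) (x : C) : q <> RtoC 0 ->
  cone_plus q (RtoC 0) alpha r x <->
  Cmod (x - q) * Cmod q * cos (alpha * PI / 2) <= inner (x - q) q /\ Cmod (x - q) <= r.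
Proof.
  intros hq; apply Cmod_gt_0 in hq; unfold cone_plus.
  replace (q - RtoC 0)%C with q by ring.
  replace (q / RtoC (Cmod q))%C with (RtoC (/ Cmod q) * q)%C
    by (unfold Cdiv; rewrite RtoC_inv by lra; ring).
  rewrite inner_scal_r; set (i := inner _ _); set (c := cos _); set (m := Cmod (x - q)).
  assert (h : m * Cmod q * c <= i <-> / Cmod q * i >= m * c); [ | tauto ].
  split; intros h.
  - apply Rle_ge, Rmult_le_reg_l with (Cmod q); trivial.
    replace (Cmod q * (/ Cmod q * i)) with i by (field; lra); lra.
  - apply Rge_le, (Rmult_le_compat_l (Cmod q)) in h; [ | lra ].
    replace (Cmod q * (/ Cmod q * i)) with i in h by (field; lra); lra.
Qed.

(** Up to lengths, the addition formula for the cosine of the angle between [W] and [d], both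
    measured from [y]. *)
Lemma inner_mult_cross (W d y : C) :
  Cmod y ^ 2 * inner W d = inner W y * inner d y + cross W y * cross d y.
Proof. rewrite Cmod_sqr; unfold inner, cross; ring. Qed.

(** The direction [W] is within [PI / 2 - beta] of [y] and [d] is within [beta] of [y], so [W] and
    [d] form an angle of at most [PI / 2]. The cross products are bounded by the complementary sine
    and cosine. *)
Lemma inner_ge_0_of_angles (W d y : C) (beta : R) :
  0 <= beta <= PI / 2 -> y <> RtoC 0 ->
  sin beta * Cmod y * Cmod W <= inner W y ->
  Cmod d * Cmod y * cos beta <= inner d y -> 0 <= inner W d.
Proof.
  intros hb hy h1 h2; apply Cmod_gt_0 in hy.
  assert (hs : 0 <= sin beta) by (apply sin_ge_0; generalize PI_RGT_0; lra).
  assert (hc : 0 <= cos beta) by (apply cos_ge_0; generalize PI_RGT_0; lra).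
  assert (hsc := sin2_cos2 beta); unfold Rsqr in hsc.
  assert (hW := Cmod_ge_0 W); assert (hd := Cmod_ge_0 d).
  assert (c1 : Rabs (cross W y) <= Cmod W * Cmod y * cos beta).
  { apply Rsqr_incr_0_var; [ | repeat apply Rmult_le_pos; lra ].
    rewrite <- Rsqr_abs; unfold Rsqr.
    assert (hL := inner_cross_sqr W y).
    assert ((sin beta * Cmod y * Cmod W) ^ 2 <= inner W y ^ 2)
      by (apply pow_incr; split; trivial; repeat apply Rmult_le_pos; lra).
    replace (Cmod W * Cmod y * cos beta * (Cmod W * Cmod y * cos beta))
      with (Cmod W ^ 2 * Cmod y ^ 2 - (sin beta * Cmod y * Cmod W) ^ 2); [ lra | ].
    replace (Cmod W * Cmod y * cos beta * (Cmod W * Cmod y * cos beta))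
      with (Cmod W ^ 2 * Cmod y ^ 2 * (cos beta * cos beta)) by ring.
    replace (cos beta * cos beta) with (1 - sin beta * sin beta) by lra; ring. }
  assert (c2 : Rabs (cross d y) <= Cmod d * Cmod y * sin beta).
  { apply Rsqr_incr_0_var; [ | repeat apply Rmult_le_pos; lra ].
    rewrite <- Rsqr_abs; unfold Rsqr.
    assert (hL := inner_cross_sqr d y).
    assert ((Cmod d * Cmod y * cos beta) ^ 2 <= inner d y ^ 2)
      by (apply pow_incr; split; trivial; repeat apply Rmult_le_pos; lra).
    replace (Cmod d * Cmod y * sin beta * (Cmod d * Cmod y * sin beta))
      with (Cmod d ^ 2 * Cmod y ^ 2 * (sin beta * sin beta)) by ring.
    replace (sin beta * sin beta) with (1 - cos beta * cos beta) by lra; nra. }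
  assert (hcr : Rabs (cross W y * cross d y)
                <= (Cmod W * Cmod y * cos beta) * (Cmod d * Cmod y * sin beta)).
  { rewrite Rabs_mult; apply Rmult_le_compat; trivial; apply Rabs_pos. }
  assert (hin : (sin beta * Cmod y * Cmod W) * (Cmod d * Cmod y * cos beta)
                <= inner W y * inner d y).
  { apply Rmult_le_compat; trivial; repeat apply Rmult_le_pos; lra. }
  apply Rabs_le_between in hcr.
  assert (h := inner_mult_cross W d y).
  apply Rmult_le_reg_l with (Cmod y ^ 2); [ now apply pow_lt | ].
  rewrite Rmult_0_r, h.
  replace (sin beta * Cmod y * Cmod W * (Cmod d * Cmod y * cos beta))
    with (Cmod W * Cmod y * cos beta * (Cmod d * Cmod y * sin beta)) in hin by ring.
  lra.
Qed.

Lemma immersion_accessible (f X Y : C -> C) (hf : immersion f X Y) (alpha r : R) :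
  f (RtoC 0) = RtoC 0 -> 0 <= alpha < 1 -> 0 < r <= 1 ->
  (forall z, Cmod z < 1 ->
     sin (alpha * PI / 2) * Cmod (f z) * Cmod (angular X Y z) <= inner (angular X Y z) (f z)) ->
  accessible alpha (image f (disk r)) (RtoC 0).
Proof.
  intros hf0 halpha hr hineq.
  assert (hpi := PI_RGT_0).
  assert (hb : 0 <= alpha * PI / 2 <= PI / 2) by nra.
  assert (h0 : image f (disk r) (RtoC 0)).
  { exists (RtoC 0); split; trivial; unfold disk; rewrite Cmod_0; lra. }
  split; [ now apply (immersion_domain_image f X Y hf) | split; trivial ].
  intros q hq.
  assert (hnq : ~ image f (disk r) q).
  { intros hin.
    destruct (immersion_image_nbhd f X Y hf r q) as [dl [hdl hd]]; [ lra | trivial | ].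
    destruct (hq (image f (disk r))) as [_ [z [hz1 hz2]]]; [ | now apply hz2 ].
    apply locally_C_iff; now exists dl. }
  assert (hq0 : q <> RtoC 0) by (intros ->; now apply hnq).
  (* The lifting argument excludes the whole unbounded cone, so the radius is an arbitrary
     choice. *)
  exists 1; split; [ lra | ]; intros x hx hin.
  apply cone_plus_0 in hx; trivial; destruct hx as [hx _].
  destruct hin as [z0 [hz0 hfz0]]; set (d := (x - q)%C) in *.
  apply hnq, (immersion_segment_lift f X Y hf r z0 q d); [ lra | exact hz0 | | ].
  { rewrite hfz0; unfold d; ring. }
  intros z s hz hs hfz.
  assert (hc : 0 <= cos (alpha * PI / 2)) by (apply cos_ge_0; lra).
  assert (hc1 := COS_bound (alpha * PI / 2)).
  set (c := cos _) in *.
  assert (hqp := proj1 (Cmod_gt_0 q) hq0).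
  assert (hd0 := Cmod_ge_0 d).
  assert (hdq : 0 <= inner d q).
  { eapply Rle_trans; [ | exact hx ]; repeat apply Rmult_le_pos; lra. }
  apply (inner_ge_0_of_angles _ d (f z) (alpha * PI / 2)); trivial.
  (* Moving from [q] by [s * d] cannot reach the origin: [d] makes no obtuse angle with [q]. *)
  - intros hfz'.
    assert (h : inner q (f z) = Cmod q ^ 2 + s * inner d q).
    { rewrite hfz, Cmod_sqr; unfold inner; destruct q, d; simpl; ring. }
    rewrite hfz' in h; replace (inner q (RtoC 0)) with 0 in h by (unfold inner; simpl; ring).
    assert (0 < Cmod q ^ 2) by now apply pow_lt.
    assert (0 <= s * inner d q) by (apply Rmult_le_pos; lra); lra.
  - apply hineq; lra.
  (* Adding [s * d] to [q] only turns it towards [d], so the angle between [d] and [f z] stays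
     within that of the cone. *)
  - rewrite hfz; fold c.
    replace (inner d (q + RtoC s * d)) with (inner d q + s * Cmod d ^ 2)
      by (rewrite Cmod_sqr; unfold inner; destruct q, d; simpl; ring).
    assert (ht := Cmod_triangle q (RtoC s * d)); rewrite Cmod_scal in ht by lra.
    assert (Cmod d * Cmod (q + RtoC s * d) * c <= Cmod d * (Cmod q + s * Cmod d) * c).
    { apply Rmult_le_compat_r; trivial; now apply Rmult_le_compat_l. }
    assert (s * Cmod d ^ 2 * c <= s * Cmod d ^ 2); [ | lra ].
    rewrite <- (Rmult_1_r (s * Cmod d ^ 2)) at 2.
    apply Rmult_le_compat_l; [ | lra ]; apply Rmult_le_pos; [ lra | now apply pow_le ].
Qed.

(** If the ray re-entered [Om], take the supremum [m] of the parameters up to [t] outside [Om]. Then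
    [m * w] is a boundary point, and its cone contains the ray just beyond it, whatever its opening;
    but those points lie in [Om]. *)
Lemma accessible_starlike (alpha : R) (Om : C -> Prop) (w : C) (t : R) :
  0 <= alpha < 1 -> accessible alpha Om (RtoC 0) -> 1 <= t -> ~ Om w -> ~ Om (RtoC t * w)%C.
Proof.
  intros halpha [[hopen _] [hOm0 hcone]] ht hw hin.
  assert (hw0 : w <> RtoC 0) by (intros ->; now apply hw).
  apply Cmod_gt_0 in hw0 as hwp.
  assert (hnear : forall s, Om (RtoC s * w)%C -> exists e, 0 < e /\
            forall s', Rabs (s' - s) < e -> Om (RtoC s' * w)%C).
  { intros s hs; destruct (proj1 (locally_C_iff _ _) (hopen _ hs)) as [dl [hdl hd]].
    exists (dl / Cmod w); split; [ now apply Rdiv_lt_0_compat | ].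
    intros s' hs'; apply hd.
    replace (RtoC s' * w - RtoC s * w)%C with (RtoC (s' - s) * w)%C
      by (rewrite RtoC_minus; ring).
    rewrite Cmod_mult, Cmod_R.
    replace dl with (dl / Cmod w * Cmod w) by (field; lra).
    now apply Rmult_lt_compat_r. }
  destruct (completeness (fun s => 1 <= s <= t /\ ~ Om (RtoC s * w)%C)) as [m [hm1 hm2]].
  { exists t; intros s [hs _]; lra. }
  { exists 1; split; [ lra | now rewrite Cmult_1_l ]. }
  assert (hm : 1 <= m <= t).
  { split; [ apply hm1; split; [ lra | now rewrite Cmult_1_l ]
           | apply hm2; intros s [hs _]; lra ]. }
  assert (hnm : ~ Om (RtoC m * w)%C).
  { intros hOm; destruct (hnear m hOm) as [e [he hs]].
    assert (hle : m <= m - e); [ | lra ].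
    apply hm2; intros s [hs1 hs2]; apply Rnot_lt_le; intros hlt; apply hs2, hs.
    assert (s <= m) by now apply hm1.
    rewrite Rabs_left1; lra. }
  assert (hmt : m < t).
  { destruct (Rle_lt_or_eq_dec m t); try lra; subst m; now destruct hnm. }
  assert (habove : forall s, m < s <= t -> Om (RtoC s * w)%C).
  { intros s hs; apply NNPP; intros hn; apply (Rlt_not_le s m); [ lra | ].
    apply hm1; split; trivial; lra. }
  assert (hstep : forall e, 0 < e -> exists s, m < s <= t /\
            Cmod (RtoC s * w - RtoC m * w) < e).
  { intros e he; exists (Rmin t (m + e / Cmod w / 2)).
    assert (hq : 0 < e / Cmod w) by now apply Rdiv_lt_0_compat.
    assert (h1 := Rmin_l t (m + e / Cmod w / 2)); assert (h2 := Rmin_r t (m + e / Cmod w / 2)).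
    assert (h3 : m < Rmin t (m + e / Cmod w / 2)) by (apply Rmin_glb_lt; lra).
    split; [ lra | ]; set (s := Rmin _ _) in *.
    replace (RtoC s * w - RtoC m * w)%C with (RtoC (s - m) * w)%C
      by (rewrite RtoC_minus; ring).
    rewrite Cmod_scal by lra.
    replace e with (e / Cmod w * Cmod w) by (field; lra).
    apply Rmult_lt_compat_r; lra. }
  destruct (hcone (RtoC m * w)%C) as [r [hr hout]].
  { intros N hN; apply locally_C_iff in hN; destruct hN as [e [he hN]]; split.
    - destruct (hstep e he) as [s [hs1 hs2]]; exists (RtoC s * w)%C; split;
        [ now apply hN | now apply habove ].
    - exists (RtoC m * w)%C; split; trivial; apply hN.
      replace (RtoC m * w - RtoC m * w)%C with (RtoC 0) by ring; now rewrite Cmod_0. }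
  destruct (hstep r hr) as [s [hs1 hs2]].
  apply (hout (RtoC s * w)%C); [ | now apply habove ].
  apply cone_plus_0.
  { apply Cmod_gt_0; rewrite Cmod_scal by lra; nra. }
  split; [ | lra ].
  replace (RtoC s * w - RtoC m * w)%C with (RtoC (s - m) * w)%C by (rewrite RtoC_minus; ring).
  rewrite !Cmod_scal by lra.
  replace (inner (RtoC (s - m) * w) (RtoC m * w)) with ((s - m) * Cmod w * (m * Cmod w)).
  2:{ replace ((s - m) * Cmod w * (m * Cmod w)) with ((s - m) * m * Cmod w ^ 2) by ring.
      rewrite Cmod_sqr; unfold inner; destruct w; simpl; ring. }
  assert (hc1 := COS_bound (alpha * PI / 2)).
  rewrite <- (Rmult_1_r ((s - m) * Cmod w * (m * Cmod w))) at 2.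
  apply Rmult_le_compat_l; [ repeat apply Rmult_le_pos; lra | lra ].
Qed.

(** * Starlikeness and injectivity *)

Lemma inner_comm (v w : C) : inner v w = inner w v.
Proof. unfold inner; ring. Qed.

Lemma inner_plus_r (v a b : C) : inner v (a + b) = inner v a + inner v b.
Proof. destruct v, a, b; unfold inner; simpl; ring. Qed.

Lemma inner_self (v : C) : inner v v = Cmod v ^ 2.
Proof. rewrite Cmod_sqr; unfold inner; ring. Qed.

(** [-(|b| a + |a| b)] makes an obtuse angle with both vectors, unless they are opposite. *)
Lemma opposite_of_no_common_descent (a b : C) :
  0 < Cmod a -> 0 < Cmod b -> (forall d, inner a d < 0 -> inner b d < 0 -> False) ->
  (RtoC (Cmod b) * a + RtoC (Cmod a) * b = RtoC 0)%C.
Proof.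
  intros ha hb hno.
  set (e := (RtoC (Cmod b) * a + RtoC (Cmod a) * b)%C).
  set (s := Cmod a * Cmod b + inner a b).
  assert (hea : inner a e = Cmod a * s).
  { unfold e, s; rewrite inner_plus_r, !inner_scal_r, inner_self; ring. }
  assert (heb : inner b e = Cmod b * s).
  { unfold e, s; rewrite inner_plus_r, !inner_scal_r, inner_self, (inner_comm b a); ring. }
  assert (hs : s <= 0).
  { apply Rnot_lt_le; intros hs; apply (hno (RtoC (-1) * e)%C); rewrite inner_scal_r, ?hea, ?heb.
    - assert (0 < Cmod a * s) by (now apply Rmult_lt_0_compat); lra.
    - assert (0 < Cmod b * s) by (now apply Rmult_lt_0_compat); lra. }
  assert (he : Cmod e ^ 2 = 2 * (Cmod a * Cmod b) * s).
  { rewrite <- inner_self.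
    change (inner e (RtoC (Cmod b) * a + RtoC (Cmod a) * b) = 2 * (Cmod a * Cmod b) * s).
    rewrite inner_plus_r, !inner_scal_r, (inner_comm e a), (inner_comm e b), hea, heb.
    ring. }
  apply Cmod_eq_0, Rle_antisym; [ | apply Cmod_ge_0 ].
  assert (0 < Cmod a * Cmod b) by now apply Rmult_lt_0_compat.
  generalize (Cmod_ge_0 e); nra.
Qed.

Definition rot (t : R) (c : C) : C :=
  (Re c * cos t - Im c * sin t, Re c * sin t + Im c * cos t).

Lemma rot_0 (c : C) : rot 0 c = c.
Proof. unfold rot; rewrite cos_0, sin_0; destruct c; apply injective_projections; simpl; ring. Qed.

Lemma Cmod_rot (t : R) (c : C) : Cmod (rot t c) = Cmod c.
Proof.
  assert (h : Cmod (rot t c) ^ 2 = Cmod c ^ 2).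
  { rewrite !Cmod_sqr; unfold rot; simpl.
    assert (hsc := sin2_cos2 t); unfold Rsqr in hsc.
    replace (_ + _) with ((Re c ^ 2 + Im c ^ 2) * (sin t * sin t + cos t * cos t))
      by (unfold Re, Im; ring).
    rewrite hsc; unfold Re, Im; ring. }
  apply Rsqr_inj; try apply Cmod_ge_0; unfold Rsqr; lra.
Qed.

Lemma is_derive_inner_rot (f X Y : C -> C) (hf : immersion f X Y) (k c : C) (t : R) :
  Cmod c < 1 ->
  is_derive (fun s => inner k (f (rot s c))) t
    (inner k (Ci * angular X Y (rot t c))).
Proof.
  intros hc.
  replace (Ci * angular X Y (rot t c))%C
    with (dlin (X (rot t c)) (Y (rot t c)) (Ci * rot t c)).
  2:{ unfold dlin, angular; apply injective_projections; simpl; ring. }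
  apply is_derive_inner_comp; [ apply (imm_diff _ _ _ hf); now rewrite Cmod_rot | | ];
    unfold rot; simpl; auto_derive; trivial; unfold Re, Im; ring.
Qed.

Lemma derive_neq_0_below (F : R -> R) (x k e : R) :
  is_derive F x k -> k <> 0 -> 0 < e -> exists y, Rabs (y - x) < e /\ F y < F x.
Proof.
  intros hF hk he; apply is_derive_Reals in hF.
  destruct (hF (Rabs k / 2)) as [[dl hdl] hd].
  { apply Rabs_pos_lt in hk; lra. }
  simpl in hd.
  assert (hm : 0 < Rmin dl e / 2) 
    by (apply Rdiv_lt_0_compat; [ now apply Rmin_pos | lra ]).
  assert (hm1 := Rmin_l dl e); assert (hm2 := Rmin_r dl e).
  set (m := Rmin dl e / 2) in *.
  destruct (Rdichotomy _ _ hk) as [hneg|hpos].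
  - exists (x + m); split;
      [ replace (x + m - x) with m by ring; rewrite Rabs_pos_eq; unfold m in *; lra | ].
    specialize (hd m); rewrite (Rabs_pos_eq m), (Rabs_left k) in hd by lra.
    assert (h := hd ltac:(lra) ltac:(unfold m; unfold m in hm; lra)).
    apply Rabs_lt_between in h.
    assert (hq : (F (x + m) - F x) / m < 0) by lra.
    apply Rmult_lt_compat_r with (r := m) in hq; trivial.
    replace ((F (x + m) - F x) / m * m) with (F (x + m) - F x) in hq by (field; lra); lra.
  - exists (x + - m); split; [ replace (x + - m - x) with (- m) by ring;
      rewrite Rabs_Ropp, Rabs_pos_eq; unfold m in *; lra | ].
    specialize (hd (- m)); rewrite Rabs_Ropp, (Rabs_pos_eq m), (Rabs_pos_eq k) in hd by lra.
    assert (h := hd ltac:(lra) ltac:(unfold m; unfold m in hm; lra)).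
    apply Rabs_lt_between in h.
    assert (hq : 0 < (F (x + - m) - F x) / - m) by lra.
    apply Rmult_lt_compat_r with (r := m) in hq; trivial.
    replace ((F (x + - m) - F x) / - m * m) with (- (F (x + - m) - F x)) in hq by (field; lra); lra.
Qed.

Lemma decompose_along (w p : C) : w <> RtoC 0 ->
  p = (RtoC (inner w p / Cmod w ^ 2) * w + RtoC (inner (Ci * w) p / Cmod w ^ 2) * (Ci * w))%C.
Proof.
  intros hw; apply Cmod_gt_0 in hw; assert (h : 0 < Cmod w ^ 2) by now apply pow_lt.
  rewrite Cmod_sqr in *; destruct w as [w1 w2], p as [p1 p2]; unfold inner; simpl in *.
  apply injective_projections; simpl; field; lra.
Qed.

(** [continuity_pt] concerns points different from [x], hence the case distinction. *)
Lemma continuity_pt_near (F : R -> R) (x e : R) : continuity_pt F x -> 0 < e ->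
  exists dl, 0 < dl /\ forall y, Rabs (y - x) < dl -> Rabs (F y - F x) < e.
Proof.
  intros h he; destruct (h e he) as [dl [hdl hd]]; exists dl; split; trivial; intros y hy.
  destruct (Req_dec x y) as [<-|hne].
  - rewrite Rminus_diag, Rabs_R0; exact he.
  - apply (hd y); repeat split; trivial.
Qed.

(** Write [f (rot t c) = P w + S (i w)].  Where [0 < P < 1], a component [S <> 0] is
    impossible: dilating by [1 / P] would give a point [w + (S / P) (i w)] of [Om]. *)
Lemma arc_along_ray (f X Y : C -> C) (hf : immersion f X Y) (Om : C -> Prop)
  (c w : C) (e eta0 : R) :
  Cmod c < 1 -> f c = w -> w <> RtoC 0 -> 0 < e -> 0 < eta0 ->
  inner (angular X Y c) w = 0 -> 0 < Cmod (angular X Y c) ->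
  (forall t, ~ Om (f (rot t c))) ->
  (forall p t, 1 <= t -> ~ Om p -> ~ Om (RtoC t * p)%C) ->
  (forall y, 0 < Rabs y < eta0 -> Om (w + RtoC y * (Ci * w))%C) ->
  exists t0, t0 < 1 /\ forall t, t0 <= t < 1 ->
    exists c', Cmod c' = Cmod c /\ Cmod (c' - c) < e /\ f c' = (RtoC t * w)%C.
Proof.
  intros hc hfc hw0 he heta hperp hW havoid hstar hline.
  assert (hwp := proj1 (Cmod_gt_0 w) hw0).
  assert (hm : 0 < Cmod w ^ 2) by now apply pow_lt.
  set (m := Cmod w ^ 2) in *.
  pose (P t := / m * inner w (f (rot t c))).
  pose (S t := / m * inner (Ci * w) (f (rot t c))).
  assert (hdP : forall t, is_derive P t (/ m * inner w (Ci * angular X Y (rot t c)))).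
  { intros t; apply is_derive_scal, (is_derive_inner_rot f X Y hf); trivial. }
  assert (hdS : forall t, is_derive S t (/ m * inner (Ci * w) (Ci * angular X Y (rot t c)))).
  { intros t; apply is_derive_scal, (is_derive_inner_rot f X Y hf); trivial. }
  assert (hcP : continuity P).
  { intros t; apply derivable_continuous_pt; eexists; apply is_derive_Reals, hdP. }
  assert (hcS : continuity S).
  { intros t; apply derivable_continuous_pt; eexists; apply is_derive_Reals, hdS. }
  assert (hP0 : P 0 = 1).
  { unfold P; rewrite rot_0, hfc, inner_self; fold m; field; lra. }
  assert (hS0 : S 0 = 0).
  { unfold S; rewrite rot_0, hfc.
    replace (inner (Ci * w) w) with 0 by (destruct w; unfold inner; simpl; ring); ring. }
  (* The normal is orthogonal to [w], so the tangent of the image arc is radial and [P] has nonzero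
     derivative at [0]. *)
  assert (hne : / m * inner w (Ci * angular X Y (rot 0 c)) <> 0).
  { rewrite rot_0; apply Rmult_integral_contrapositive; split;
      [ apply Rinv_neq_0_compat; lra | ].
    assert (h := inner_cross_sqr (angular X Y c) w); rewrite hperp in h.
    replace (inner w (Ci * angular X Y c)) with (cross (angular X Y c) w)
      by (destruct w; unfold inner, cross; simpl; ring).
    intros h0; rewrite h0 in h.
    assert (0 < Cmod (angular X Y c) ^ 2 * Cmod w ^ 2)
      by (apply Rmult_lt_0_compat; now apply pow_lt); lra. }
  assert (hcRe : continuity_pt (fun t => Re (rot t c)) 0).
  { apply derivable_continuous_pt; unfold rot; simpl; eexists; apply is_derive_Reals.
    auto_derive; trivial. }
  assert (hcIm : continuity_pt (fun t => Im (rot t c)) 0).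
  { apply derivable_continuous_pt; unfold rot; simpl; eexists; apply is_derive_Reals.
    auto_derive; trivial. }
  assert (he2 : 0 < e / 2) by lra.
  destruct (continuity_pt_near _ _ _ hcRe he2) as [d1 [hd1 hn1]].
  destruct (continuity_pt_near _ _ _ hcIm he2) as [d2 [hd2 hn2]].
  (* The thresholds [1 / 2] for [P] and [eta0 / 2] for [S] match: dilation by [1 / P] less than
     doubles [S], which keeps it below [eta0]. *)
  assert (hhalf : 0 < 1 / 2) by lra.
  destruct (continuity_pt_near _ _ _ (hcP 0) hhalf) as [d3 [hd3 hn3]].
  assert (heta2 : 0 < eta0 / 2) by lra.
  destruct (continuity_pt_near _ _ _ (hcS 0) heta2) as [d4 [hd4 hn4]].
  destruct (derive_neq_0_below P 0 _ (Rmin (Rmin d1 d2) (Rmin d3 d4)) (hdP 0) hne)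
    as [th [hth hlt]].
  { repeat apply Rmin_pos; trivial. }
  rewrite Rminus_0_r in hth; rewrite hP0 in hlt.
  assert (hall : forall t, Rabs t <= Rabs th ->
    Cmod (rot t c - c) < e /\ 1 / 2 < P t /\ Rabs (S t) < eta0 / 2).
  { intros t ht.
    assert (ht' : Rabs (t - 0) < Rmin (Rmin d1 d2) (Rmin d3 d4)) by (rewrite Rminus_0_r; lra).
    assert (hd12 := Rlt_le_trans _ _ _ ht' (Rmin_l _ _)).
    assert (hd34 := Rlt_le_trans _ _ _ ht' (Rmin_r _ _)).
    specialize (hn1 t (Rlt_le_trans _ _ _ hd12 (Rmin_l _ _))).
    specialize (hn2 t (Rlt_le_trans _ _ _ hd12 (Rmin_r _ _))).
    specialize (hn3 t (Rlt_le_trans _ _ _ hd34 (Rmin_l _ _))).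
    specialize (hn4 t (Rlt_le_trans _ _ _ hd34 (Rmin_r _ _))).
    rewrite rot_0 in hn1, hn2; rewrite hP0 in hn3; rewrite hS0, Rminus_0_r in hn4.
    split; [ | split; trivial ].
    - eapply Rle_lt_trans; [ apply Cmod_le_abs | ].
      replace e with (e / 2 + e / 2) by field; now apply Rplus_lt_compat.
    - apply Rabs_lt_between in hn3; lra. }
  exists (P th); split; trivial; intros t ht.
  destruct (IVT_gen P 0 th t hcP) as [s [hs hPs]].
  { rewrite hP0, Rmin_right, Rmax_left by lra; lra. }
  assert (hsth : Rabs s <= Rabs th).
  { revert hs; unfold Rmin, Rmax, Rabs; repeat destruct Rle_dec; repeat destruct Rcase_abs; lra. }
  destruct (hall s hsth) as [hnear [hPpos hSs]].
  exists (rot s c); split; [ apply Cmod_rot | split; trivial ].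
  assert (hdec := decompose_along w (f (rot s c)) hw0); fold m in hdec.
  replace (inner w (f (rot s c)) / m) with t in hdec by (rewrite <- hPs; unfold P; field; lra).
  replace (inner (Ci * w) (f (rot s c)) / m) with (S s) in hdec by (unfold S; field; lra).
  assert (ht0 : 1 / 2 < t) by lra.
  destruct (Req_dec (S s) 0) as [h0|h0]; [ rewrite hdec, h0; ring | exfalso ].
  apply (hstar (f (rot s c)) (/ t)); [ | apply havoid | ].
  { rewrite <- Rinv_1 at 1; apply Rinv_le_contravar; lra. }
  assert (htC : RtoC t <> RtoC 0) by (intros h; injection h; lra).
  replace (RtoC (/ t) * f (rot s c))%C with (w + RtoC (S s / t) * (Ci * w))%C.
  2:{ rewrite hdec, RtoC_div, RtoC_inv by lra; now field. }
  apply hline; unfold Rdiv; rewrite Rabs_mult, Rabs_inv, (Rabs_pos_eq t) by lra.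
  assert (hi : 0 < / t) by (apply Rinv_0_lt_compat; lra).
  assert (hi2 : / t < 2).
  { rewrite <- (Rinv_inv 2); apply Rinv_lt_contravar; lra. }
  apply Rabs_pos_lt in h0; nra.
Qed.

(** Among the pairs [a <> b] with [f a = f b], choose one minimising first
    [rho = max |a| |b|] and then [|f a|].  Both points then lie on the circle of radius
    [rho], and since [f] is injective inside, the images of the circle near [a] and [b]
    touch at [w = f a] from opposite sides; starlikeness makes the common tangent radial
    and lets both arcs run inwards along the ray through [w], so [|f a|] was not minimal. *)
Lemma immersion_injective (f X Y : C -> C) (hf : immersion f X Y) :
  f (RtoC 0) = RtoC 0 ->
  (forall r p t, 0 < r < 1 -> 1 <= t ->
     ~ image f (disk r) p -> ~ image f (disk r) (RtoC t * p)%C) ->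
  forall a b, Cmod a < 1 -> Cmod b < 1 -> f a = f b -> a = b.
Proof.
  intros hf0 hstar a0 b0 ha0 hb0 hab0; apply NNPP; intros hne0.
  pose (R0 := Rmax (Cmod a0) (Cmod b0)).
  assert (hR0 : R0 < 1) by now apply Rmax_lub_lt.
  (* The condition [a <> b] survives limits because, by local injectivity, double points cannot
     merge. *)
  assert (hclosed : forall M, M < 1 ->
    seq_closed (fun a b => Cmod a <= M /\ Cmod b <= M /\ a <> b /\ f a = f b)).
  { intros M hM u v a b hQ hu hv.
    assert (ha : Cmod a <= M).
    { apply (is_lim_seq_le (fun n => Cmod (u n)) (fun _ => M) (Cmod a) M);
        [ apply hQ | now apply cvg_Cmod | apply is_lim_seq_const ]. }
    assert (hb : Cmod b <= M).
    { apply (is_lim_seq_le (fun n => Cmod (v n)) (fun _ => M) (Cmod b) M);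
        [ apply hQ | now apply cvg_Cmod | apply is_lim_seq_const ]. }
    repeat split; trivial.
    - intros ->; apply (immersion_locally_injective f X Y hf u v b); trivial;
        [ lra | apply hQ | apply hQ ].
    - apply (cvg_unique (fun n => f (u n))).
      + apply (immersion_cvg f X Y hf); trivial; lra.
      + assert (h : cvg (fun n => f (v n)) (f b)) by (apply (immersion_cvg f X Y hf); trivial; lra).
        apply cvg_eps; intros e he; destruct (proj1 (cvg_eps _ _) h e he) as [n0 hn].
        exists n0; intros n hn'; replace (f (u n)) with (f (v n)) by (symmetry; apply hQ).
        now apply hn. }
  destruct (min_attained (fun a b => Cmod a <= R0 /\ Cmod b <= R0 /\ a <> b /\ f a = f b)
    (fun a b => Rmax (Cmod a) (Cmod b)) R0 0) as [a1 [b1 [hQ1 hmin1]]].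
  { exists a0, b0; repeat split; trivial; [ apply Rmax_l | apply Rmax_r ]. }
  { intros a b h; split; apply h. }
  { intros a b h; eapply Rle_trans; [ apply Cmod_ge_0 | apply Rmax_l ]. }
  { now apply hclosed. }
  { intros u v a b _ _ hu hv; apply cvg_Cmod in hu, hv.
    apply is_lim_seq_ext with
      (fun n => / 2 * (Cmod (u n) + Cmod (v n) + Rabs (Cmod (u n) - Cmod (v n)))).
    { intros n; unfold Rmax, Rabs; destruct Rle_dec, Rcase_abs; lra. }
    replace (Rmax (Cmod a) (Cmod b)) with (/ 2 * (Cmod a + Cmod b + Rabs (Cmod a - Cmod b)))
      by (unfold Rmax, Rabs; destruct Rle_dec, Rcase_abs; lra).
    apply is_lim_seq_mult'; [ apply is_lim_seq_const | ].
    apply is_lim_seq_plus'; [ now apply is_lim_seq_plus' | ].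
    now apply (is_lim_seq_abs _ (Finite _)), is_lim_seq_minus'. }
  set (rho := Rmax (Cmod a1) (Cmod b1)) in *.
  assert (hrho1 : rho < 1) by (apply Rle_lt_trans with R0; trivial; apply Rmax_lub; apply hQ1).
  assert (hmin : forall a b, a <> b -> f a = f b -> Cmod a < rho -> Cmod b <= rho -> Cmod b = rho).
  { intros a b hne heq ha hb; apply Rle_antisym; trivial.
    assert (hrR : rho <= R0) by (apply Rmax_lub; apply hQ1).
    assert (h := hmin1 a b); assert (h' : rho <= Rmax (Cmod a) (Cmod b))
      by (apply h; repeat split; trivial; lra).
    revert h'; unfold Rmax; destruct Rle_dec; lra. }
  destruct (min_attained (fun a b => Cmod a <= rho /\ Cmod b <= rho /\ a <> b /\ f a = f b)
    (fun a _ => Cmod (f a)) rho 0) as [a [b [[ha [hb [hne heq]]] hmin2]]].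
  { exists a1, b1; split; [ apply Rmax_l | split; [ apply Rmax_r | apply hQ1 ] ]. }
  { intros a b h; split; apply h. }
  { intros; apply Cmod_ge_0. }
  { now apply hclosed. }
  { intros u v a b _ [ha _] hu _; apply cvg_Cmod, (immersion_cvg f X Y hf); trivial; lra. }
  clearbody rho; clear hclosed hmin1 a1 b1 hQ1 hne0 hab0 ha0 hb0 R0 hR0 a0 b0.
  assert (hrho0 : 0 < rho).
  { apply Rnot_le_lt; intros hle; apply hne.
    assert (h1 : a = RtoC 0) by (apply Cmod_eq_0; generalize (Cmod_ge_0 a); lra).
    assert (h2 : b = RtoC 0) by (apply Cmod_eq_0; generalize (Cmod_ge_0 b); lra).
    congruence. }
  set (Om := image f (disk rho)) in *.
  assert (hW : forall c, Cmod c = rho -> 0 < Cmod (angular X Y c)).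
  { intros c hc; apply (angular_neq_0 f X Y hf); [ lra | ].
    intros ->; rewrite Cmod_0 in hc; lra. }
  (* If [f c = f e] with [e] inside the circle, push [c] inwards along minus its normal and let a
     preimage near [e] follow. This gives two distinct points strictly inside with equal values,
     against the minimality of [rho]. *)
  assert (havoid : forall c, Cmod c = rho -> ~ Om (f c)).
  { intros c hc [e [he hfe]]; unfold disk in he.
    assert (hce : 0 < Cmod (c - e) / 2).
    { assert (h := Cmod_sub_ge c e); lra. }
    destruct (immersion_local_solve f X Y hf e (Rmin (rho - Cmod e) (Cmod (c - e) / 2)))
      as [dl [hdl hs]]; [ lra | apply Rmin_pos; lra | ].
    pose (d := (- angular X Y c)%C).
    destruct (immersion_enter f X Y hf c d (Cmod (c - e) / 2)) as [eta0 [heta0 henter]];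
      [ lra | trivial | | ].
    { replace (inner (angular X Y c) d) with (- Cmod (angular X Y c) ^ 2)
        by (rewrite Cmod_sqr; unfold d, inner; simpl; ring).
      assert (0 < Cmod (angular X Y c) ^ 2) by (apply pow_lt; now apply hW); lra. }
    assert (hd : Cmod d = Cmod (angular X Y c)) by apply Cmod_opp.
    assert (hdp : 0 < Cmod d) by (rewrite hd; now apply hW).
    pose (eta := Rmin eta0 (dl / Cmod d) / 2).
    assert (hdd : 0 < dl / Cmod d) by now apply Rdiv_lt_0_compat.
    assert (hm : 0 < Rmin eta0 (dl / Cmod d)) by now apply Rmin_pos.
    assert (hm1 := Rmin_l eta0 (dl / Cmod d)); assert (hm2 := Rmin_r eta0 (dl / Cmod d)).
    destruct (henter eta) as [c' [hc'1 [hc'2 hc'3]]]; [ unfold eta; lra | ].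
    destruct (hs (f c')) as [e' [_ [he' [hfe' _]]]].
    { rewrite hc'3, hfe.
      replace (f c + RtoC eta * d - f c)%C with (RtoC eta * d)%C by ring.
      rewrite Cmod_scal by (unfold eta; lra).
      replace dl with (dl / Cmod d * Cmod d) by (field; lra).
      apply Rmult_lt_compat_r; trivial; unfold eta; lra. }
    assert (h1 := Rlt_le_trans _ _ _ he' (Rmin_l _ _)).
    assert (h2 := Rlt_le_trans _ _ _ he' (Rmin_r _ _)).
    assert (h3 := Cmod_sub_ge e' e).
    assert (hlt : Cmod c' = rho); [ | lra ].
    apply (hmin e' c'); trivial; try lra.
    intros ->.
    assert (ht := Cmod_triangle (c - c') (c' - e)).
    replace (c - c' + (c' - e))%C with (c - e)%C in ht by ring.
    rewrite (Cmod_sub_comm c c') in ht; lra. }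
  assert (hra : Cmod a = rho).
  { destruct (Rle_lt_or_eq_dec _ _ ha) as [hlt|]; trivial; exfalso.
    apply (havoid b); [ now apply (hmin a b) | exists a; now split ]. }
  assert (hrb : Cmod b = rho).
  { destruct (Rle_lt_or_eq_dec _ _ hb) as [hlt|]; trivial; exfalso.
    apply (havoid a); [ assumption | exists b; now split ]. }
  set (w := f a) in *.
  assert (hwOm : ~ Om w) by now apply havoid.
  assert (hw0 : w <> RtoC 0).
  { intros h; apply hwOm; rewrite h; exists (RtoC 0); split; trivial.
    unfold disk; now rewrite Cmod_0. }
  assert (hwp := proj1 (Cmod_gt_0 w) hw0).
  assert (hab : 0 < Cmod (a - b) / 2).
  { assert (0 < Cmod (a - b)); [ | lra ].
    apply Cmod_gt_0; intros h; apply hne.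
    replace a with (a - b + b)%C by ring; rewrite h; ring. }
  (* A direction that leads inwards at both [a] and [b] would again give a pair strictly inside, so
     the two normals are opposite. *)
  assert (hopp : (RtoC (Cmod (angular X Y b)) * angular X Y a
                  + RtoC (Cmod (angular X Y a)) * angular X Y b = RtoC 0)%C).
  { apply opposite_of_no_common_descent; try now apply hW.
    intros d hda hdb.
    destruct (immersion_enter f X Y hf a d (Cmod (a - b) / 2)) as [e1 [he1 h1]]; try lra.
    destruct (immersion_enter f X Y hf b d (Cmod (a - b) / 2)) as [e2 [he2 h2]]; try lra.
    assert (hm : 0 < Rmin e1 e2) by now apply Rmin_pos.
    assert (hm1 := Rmin_l e1 e2); assert (hm2 := Rmin_r e1 e2).
    destruct (h1 (Rmin e1 e2 / 2)) as [a' [ha1 [ha2 ha3]]]; [ lra | ].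
    destruct (h2 (Rmin e1 e2 / 2)) as [b' [hb1 [hb2 hb3]]]; [ lra | ].
    assert (h : Cmod b' = rho); [ | lra ].
    apply (hmin a' b'); try lra.
    - intros ->.
      assert (ht := Cmod_triangle (a - b') (b' - b)).
      replace (a - b' + (b' - b))%C with (a - b)%C in ht by ring.
      rewrite (Cmod_sub_comm a b') in ht; lra.
    - rewrite ha3, hb3; fold w; now rewrite heq. }
  (* Otherwise a slight dilation of [w] would lie in [Om] although [w] does not. Applied to two
     opposite normals, this forces both products with [w] to vanish. *)
  assert (hrad : forall c, Cmod c = rho -> f c = w -> 0 <= inner (angular X Y c) w).
  { intros c hc hfc; apply Rnot_lt_le; intros hlt.
    destruct (immersion_enter f X Y hf c w 1) as [e1 [he1 h1]]; try lra.
    destruct (h1 (e1 / 2)) as [c' [hc1 [_ hc3]]]; [ lra | ].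
    apply (hstar rho w (1 + e1 / 2)); trivial; try lra.
    exists c'; split; [ unfold disk; lra | ].
    rewrite hc3, hfc, RtoC_plus; ring. }
  assert (hra' := hrad a hra eq_refl); assert (hrb' := hrad b hrb (eq_sym heq)).
  assert (hWa := hW a hra); assert (hWb := hW b hrb).
  set (Wa := angular X Y a) in *; set (Wb := angular X Y b) in *.
  assert (hoppi : forall v, Cmod Wb * inner Wa v + Cmod Wa * inner Wb v = 0).
  { intros v; rewrite (inner_comm Wa), (inner_comm Wb), <- !inner_scal_r, <- inner_plus_r, hopp.
    unfold inner; simpl; ring. }
  assert (hwa : inner Wa w = 0 /\ inner Wb w = 0).
  { assert (h := hoppi w).
    assert (0 <= Cmod Wb * inner Wa w) by (apply Rmult_le_pos; lra).
    assert (0 <= Cmod Wa * inner Wb w) by (apply Rmult_le_pos; lra).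
    assert (h1 : Cmod Wb * inner Wa w = 0) by lra.
    assert (h2 : Cmod Wa * inner Wb w = 0) by lra.
    apply Rmult_integral in h1; apply Rmult_integral in h2; split; lra. }
  destruct hwa as [hwa hwb].
  assert (hiw : inner Wa (Ci * w) <> 0).
  { intros h0; assert (h := inner_cross_sqr Wa w).
    replace (cross Wa w) with (- inner Wa (Ci * w)) in h
      by (destruct w; unfold cross, inner; simpl; ring).
    rewrite hwa, h0 in h.
    assert (0 < Cmod Wa ^ 2 * Cmod w ^ 2) by (apply Rmult_lt_0_compat; now apply pow_lt).
    lra. }
  (* Of two opposite normals, neither orthogonal to [d], one has a negative product with [d]; so
     [w + y * d] comes from an interior point near [a] or near [b]. This is used for [Ci * w] and
     its negative. *)
  assert (hline : exists eta0, 0 < eta0 /\ forall y, 0 < Rabs y < eta0 ->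
                    Om (w + RtoC y * (Ci * w))%C).
  { assert (hside : forall d, inner Wa d <> 0 -> exists eta0, 0 < eta0 /\
              forall y, 0 < y < eta0 -> Om (w + RtoC y * d)%C).
    { intros d hd; destruct (Rdichotomy _ _ hd) as [hlt|hgt].
      - destruct (immersion_enter f X Y hf a d 1) as [e1 [he1 h1]]; try lra; trivial.
        exists e1; split; trivial; intros y hy; destruct (h1 y hy) as [c [hc1 [_ hc3]]].
        exists c; split; [ unfold disk; lra | exact hc3 ].
      - destruct (immersion_enter f X Y hf b d 1) as [e1 [he1 h1]]; try lra.
        { assert (h := hoppi d).
          assert (0 < Cmod Wb * inner Wa d) by now apply Rmult_lt_0_compat.
          fold Wb; apply Rnot_le_lt; intros hle.
          assert (0 <= Cmod Wa * inner Wb d) by (apply Rmult_le_pos; lra); lra. }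
        exists e1; split; trivial; intros y hy; destruct (h1 y hy) as [c [hc1 [_ hc3]]].
        exists c; split; [ unfold disk; lra | now rewrite hc3, <- heq ]. }
    destruct (hside (Ci * w)%C hiw) as [e1 [he1 h1]].
    destruct (hside (RtoC (-1) * (Ci * w))%C) as [e2 [he2 h2]].
    { rewrite inner_scal_r; lra. }
    exists (Rmin e1 e2); split; [ now apply Rmin_pos | ]; intros y hy.
    assert (hm1 := Rmin_l e1 e2); assert (hm2 := Rmin_r e1 e2).
    destruct (Rle_lt_dec 0 y) as [hy0|hy0].
    - rewrite Rabs_pos_eq in hy by trivial; apply h1; lra.
    - rewrite Rabs_left in hy by trivial.
      replace (RtoC y * (Ci * w))%C with (RtoC (- y) * (RtoC (-1) * (Ci * w)))%C
        by (rewrite !RtoC_opp; ring).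
      apply h2; lra. }
  destruct hline as [eta0 [heta0 hline]].
  assert (harc : forall c, Cmod c = rho -> f c = w -> inner (angular X Y c) w = 0 ->
    exists t0, t0 < 1 /\ forall t, t0 <= t < 1 -> exists c', Cmod c' = Cmod c /\
      Cmod (c' - c) < Cmod (a - b) / 2 /\ f c' = (RtoC t * w)%C).
  { intros c hc hfc hperp.
    apply (arc_along_ray f X Y hf Om c w (Cmod (a - b) / 2) eta0); trivial.
    - lra.
    - now apply hW.
    - intros t; apply havoid; now rewrite Cmod_rot.
    - intros p t ht; apply hstar; trivial; lra. }
  destruct (harc a hra eq_refl hwa) as [t1 [ht1 h1]].
  destruct (harc b hrb (eq_sym heq) hwb) as [t2 [ht2 h2]].
  (* A common parameter below [1]; the bound [0] makes [t * Cmod w] the modulus of [t * w], which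
     then undercuts the minimal value. *)
  pose (t := Rmax 0 (Rmax t1 t2)).
  assert (hta := Rmax_l 0 (Rmax t1 t2)); assert (htb := Rmax_r 0 (Rmax t1 t2)).
  assert (htc := Rmax_l t1 t2); assert (htd := Rmax_r t1 t2).
  assert (ht : t < 1) by (repeat apply Rmax_lub_lt; lra).
  fold t in hta, htb.
  destruct (h1 t) as [a' [ha1 [ha2 ha3]]]; [ lra | ].
  destruct (h2 t) as [b' [hb1 [hb2 hb3]]]; [ lra | ].
  assert (hle : Cmod w <= Cmod (f a')).
  { apply (hmin2 a' b'); repeat split; try lra; [ | congruence ].
    intros ->.
    assert (htr := Cmod_triangle (a - b') (b' - b)).
    replace (a - b' + (b' - b))%C with (a - b)%C in htr by ring.
    rewrite (Cmod_sub_comm a b') in htr; lra. }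
  rewrite ha3, Cmod_scal in hle by lra; nra.
Qed.

(** * From the cone condition to the inequality *)

Lemma accessible_angle (f X Y : C -> C) (hf : immersion f X Y) (alpha : R) :
  f (RtoC 0) = RtoC 0 -> 0 <= alpha < 1 ->
  (forall r, 0 < r < 1 -> accessible alpha (image f (disk r)) (RtoC 0)) ->
  forall z, Cmod z < 1 ->
  sin (alpha * PI / 2) * Cmod (f z) * Cmod (angular X Y z) <= inner (angular X Y z) (f z).
Proof.
  intros hf0 halpha hacc z hz.
  destruct (Req_dec (Cmod z) 0) as [hz0|hz0].
  { apply Cmod_eq_0 in hz0; rewrite hz0, hf0, Cmod_0; unfold inner; simpl; lra. }
  set (r := Cmod z) in *.
  assert (hr : 0 < r < 1) by (generalize (Cmod_ge_0 z); fold r; lra).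
  assert (hinj := immersion_injective f X Y hf hf0
    (fun r p t hr => accessible_starlike alpha _ p t halpha (hacc r hr))).
  assert (hnw : ~ image f (disk r) (f z)).
  { intros [z' [hz' heq]]; unfold disk in hz'.
    apply hinj in heq; [ subst z'; unfold r in hz'; lra | lra | exact hz ]. }
  assert (hzn : z <> RtoC 0) by (intros h; apply hz0; unfold r; rewrite h; apply Cmod_0).
  assert (hW : 0 < Cmod (angular X Y z)) by now apply (angular_neq_0 f X Y hf).
  set (W := angular X Y z) in *.
  set (w := f z) in *.
  assert (hw0 : w <> RtoC 0).
  { intros h; apply hnw; rewrite h; exists (RtoC 0); split; trivial.
    unfold disk; rewrite Cmod_0; lra. }
  assert (hwp := proj1 (Cmod_gt_0 w) hw0).
  destruct (hacc r hr) as [_ [_ hcone]].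
  (* [w] is a boundary point: by injectivity it is not in the image of the open disc of radius [r],
     and moving from it along [- W] enters that image. *)
  destruct (hcone w) as [s [hs hout]].
  { intros N hN; apply locally_C_iff in hN; destruct hN as [e [he hN]]; split.
    - destruct (immersion_enter f X Y hf z (- W)%C 1) as [e1 [he1 h1]]; [ exact hz | lra | | ].
      { fold W; replace (inner W (- W)) with (- Cmod W ^ 2)
          by (rewrite Cmod_sqr; unfold inner; simpl; ring).
        assert (0 < Cmod W ^ 2) by now apply pow_lt. lra. }
      pose (eta := Rmin e1 (e / Cmod W) / 2).
      assert (hdd : 0 < e / Cmod W) by now apply Rdiv_lt_0_compat.
      assert (hm : 0 < Rmin e1 (e / Cmod W)) by now apply Rmin_pos.
      assert (hm1 := Rmin_l e1 (e / Cmod W)); assert (hm2 := Rmin_r e1 (e / Cmod W)).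
      destruct (h1 eta) as [z' [hz'1 [_ hz'3]]]; [ unfold eta; lra | ].
      exists (f z'); split; [ apply hN | now exists z' ].
      rewrite hz'3; fold w.
      replace (w + RtoC eta * - W - w)%C with (- (RtoC eta * W))%C by ring.
      rewrite Cmod_opp, Cmod_scal by (unfold eta; lra).
      replace e with (e / Cmod W * Cmod W) by (field; lra).
      apply Rmult_lt_compat_r; trivial; unfold eta; lra.
    - exists w; split; trivial; apply hN.
      replace (w - w)%C with (RtoC 0) by ring; now rewrite Cmod_0. }
  assert (hpi := PI_RGT_0).
  set (beta := alpha * PI / 2) in *.
  assert (hb : 0 <= beta < PI / 2) by (unfold beta; nra).
  assert (hsn : 0 <= sin beta) by (apply sin_ge_0; lra).
  assert (hcs : 0 < cos beta) by (apply cos_gt_0; lra).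
  assert (hsc := sin2_cos2 beta); unfold Rsqr in hsc.
  (* The two signs of [sg] give the edges of the cone, namely [w] turned by [beta] and by [- beta].
     A negative product with [W] would put points of such an edge near [w] into the image. *)
  assert (hdir : forall sg, sg * sg = sin beta * sin beta ->
            0 <= inner W w * cos beta + sg * cross w W).
  { intros sg hsg; pose (d := ((cos beta, sg) * w)%C).
    assert (hdW : inner W d = inner W w * cos beta + sg * cross w W)
      by (unfold d, inner, cross; destruct w; simpl; ring).
    assert (hdw : inner d w = Cmod w ^ 2 * cos beta)
      by (rewrite Cmod_sqr; unfold d, inner; destruct w; simpl; ring).
    assert (hd : Cmod d = Cmod w).
    { unfold d; rewrite Cmod_mult.
      replace (Cmod (cos beta, sg)) with 1; [ ring | ].
      unfold Cmod; simpl; rewrite <- sqrt_1 at 1; f_equal; lra. }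
    rewrite <- hdW; apply Rnot_lt_le; intros hlt.
    destruct (immersion_enter f X Y hf z d 1) as [e1 [he1 h1]]; [ exact hz | lra | exact hlt | ].
    pose (eta := Rmin e1 (s / Cmod w) / 2).
    assert (hdd : 0 < s / Cmod w) by now apply Rdiv_lt_0_compat.
    assert (hm : 0 < Rmin e1 (s / Cmod w)) by now apply Rmin_pos.
    assert (hm1 := Rmin_l e1 (s / Cmod w)); assert (hm2 := Rmin_r e1 (s / Cmod w)).
    assert (heta : 0 < eta) by (unfold eta; lra).
    destruct (h1 eta) as [z' [hz'1 [_ hz'3]]]; [ unfold eta; lra | ].
    apply (hout (f z')); [ | now exists z' ].
    apply cone_plus_0; trivial; rewrite hz'3; fold w.
    replace (w + RtoC eta * d - w)%C with (RtoC eta * d)%C by ring.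
    rewrite Cmod_scal, hd by lra; split.
    - rewrite inner_comm, inner_scal_r, inner_comm, hdw; fold beta; right; ring.
    - replace s with (s / Cmod w * Cmod w) by (field; lra).
      apply Rmult_le_compat_r; [ lra | unfold eta; lra ]. }
  assert (hp := hdir (sin beta) eq_refl).
  assert (hn := hdir (- sin beta) ltac:(ring)).
  assert (hX : 0 <= inner W w).
  { apply Rnot_lt_le; intros hlt.
    assert (inner W w * cos beta < 0) by nra; lra. }
  apply Rsqr_incr_0_var; trivial; unfold Rsqr.
  assert (hL := inner_cross_sqr w W); rewrite (inner_comm w W) in hL.
  set (x := inner W w) in *; set (y := cross w W) in *.
  (* The two edges give [Rabs y * sin beta <= x * cos beta]. Squaring and adding
     [x ^ 2 * sin beta ^ 2] to both sides bounds [(x ^ 2 + y ^ 2) * sin beta ^ 2] by [x ^ 2], which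
     is the claim squared. *)
  assert (hxy : (y * sin beta) ^ 2 <= (x * cos beta) ^ 2).
  { assert (0 <= (x * cos beta - y * sin beta) * (x * cos beta + y * sin beta)); [ | nra ].
    apply Rmult_le_pos; lra. }
  replace (sin beta * Cmod w * Cmod W * (sin beta * Cmod w * Cmod W))
    with (sin beta * sin beta * (Cmod w ^ 2 * Cmod W ^ 2)) by ring.
  rewrite <- hL.
  replace ((x * cos beta) ^ 2) with (x ^ 2 * (1 - sin beta * sin beta)) in hxy
    by (replace (1 - sin beta * sin beta) with (cos beta * cos beta) by lra; ring).
  nra.
Qed.

(** * Polyharmonic maps *)

Lemma locally_unit_disk (z : C) : unit_disk z -> locally (T := C_UniformSpace) z unit_disk.
Proof.
  intros hz; unfold unit_disk, disk in *; apply locally_C_iff.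
  exists (1 - Cmod z); split; [ lra | ].
  intros w hw; generalize (Cmod_sub_ge w z); lra.
Qed.

Lemma continuous_cvg (f : C -> C) (u : nat -> C) (z : C) :
  continuous (T := C_UniformSpace) (U := C_UniformSpace) f z ->
  cvg u z -> cvg (fun n => f (u n)) (f z).
Proof.
  intros hf hu; apply cvg_eps; intros eps he.
  assert (hN : locally (T := C_UniformSpace) (f z) (fun w => Cmod (w - f z) < eps))
    by (apply locally_C_iff; now exists eps).
  apply hf, locally_C_iff in hN; destruct hN as [dl [hdl hd]].
  destruct (proj1 (cvg_eps u z) hu dl hdl) as [n0 hn]; exists n0; intros n h.
  now apply hd, hn.
Qed.

Lemma differentiable_pt_lim_of_partials (f g : C -> R) (z : C) (d : R) :
  locally (T := C_UniformSpace) z (fun w => is_derive (fun t => f (t, Im w)) (Re w) (g w)) ->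
  is_derive (fun t => f (Re z, t)) (Im z) d ->
  continuous (T := C_UniformSpace) (U := R_UniformSpace) g z ->
  differentiable_pt_lim (fun x y => f (x, y)) (Re z) (Im z) (g z) d.
Proof.
  intros h1 h2 h3; apply filterdiff_differentiable_pt_lim.
  destruct z as [x y].
  apply (is_derive_filterdiff (fun x y => f (x, y)) x y (fun x y => g (x, y)) d); trivial.
  - revert h1; apply filter_imp; intros [u v] hu; exact hu.
  - apply continuous_ext with g; [ now intros [u v] | exact h3 ].
Qed.

Lemma has_differential_of_parts (f : C -> C) (z a b : C) :
  differentiable_pt_lim (fun x y => Re (f (x, y))) (Re z) (Im z) (Re a) (Re b) ->
  differentiable_pt_lim (fun x y => Im (f (x, y))) (Re z) (Im z) (Im a) (Im b) ->
  has_differential f z a b.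
Proof.
  intros h1 h2 eps he; assert (he2 : 0 < eps / 2) by lra.
  destruct (h1 (mkposreal _ he2)) as [[d1 hd1] k1].
  destruct (h2 (mkposreal _ he2)) as [[d2 hd2] k2]; simpl in k1, k2.
  exists (Rmin d1 d2); split; [ now apply Rmin_pos | ]; intros u hu.
  assert (hu1 := Rlt_le_trans _ _ _ hu (Rmin_l _ _)).
  assert (hu2 := Rlt_le_trans _ _ _ hu (Rmin_r _ _)).
  assert (hre := Re_le_Cmod u); assert (him := Im_le_Cmod u).
  specialize (k1 (Re (z + u)) (Im (z + u))); specialize (k2 (Re (z + u)) (Im (z + u))).
  replace (Re (z + u) - Re z) with (Re u) in * by (destruct z, u; simpl; ring).
  replace (Im (z + u) - Im z) with (Im u) in * by (destruct z, u; simpl; ring).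
  specialize (k1 ltac:(lra) ltac:(lra)); specialize (k2 ltac:(lra) ltac:(lra)).
  replace (Re (z + u), Im (z + u)) with (z + u)%C in * by (now destruct z, u).
  replace (Re z, Im z) with z in * by (now destruct z).
  assert (hm : Rmax (Rabs (Re u)) (Rabs (Im u)) <= Cmod u) by now apply Rmax_lub.
  apply (Rmult_le_compat_l (eps / 2)) in hm; [ | lra ].
  eapply Rle_trans; [ apply Cmod_le_abs | ].
  assert (hparts : forall v w : C,
    Re (v - w - dlin a b u) = Re v - Re w - (Re a * Re u + Re b * Im u) /\
    Im (v - w - dlin a b u) = Im v - Im w - (Im a * Re u + Im b * Im u))
    by (intros; unfold dlin, Re, Im; simpl; split; ring).
  destruct (hparts (f (z + u)%C) (f z)) as [-> ->].
  lra.
Qed.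

Lemma cross_dx_dy (f : C -> C) (z : C) : cross (dx f z) (dy f z) = jacobian f z.
Proof.
  unfold jacobian, d_z, d_zbar; rewrite !Cmod_sqr; unfold cross.
  destruct (dx f z), (dy f z); simpl; field.
Qed.

Lemma p_harmonic_immersion (p : nat) (f : C -> C) : (1 <= p)%nat ->
  p_harmonic p unit_disk f -> (forall z, unit_disk z -> jacobian f z > 0) ->
  immersion f (dx f) (dy f).
Proof.
  intros hp [hC _] hJ; destruct p as [|p]; [ lia | ].
  (* Two explicit successors let [Cn_on] unfold down to the continuity of both first partials. *)
  replace (2 * S p)%nat with (S (S (2 * p))) in hC by lia.
  destruct hC as [_ [hex [[hcX _] [hcY _]]]].
  constructor.
  - intros z hz.
    assert (hre : forall k : C -> R,
      (forall w, continuous (T := C_UniformSpace) (U := R_UniformSpace) k w) ->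
      continuous (T := C_UniformSpace) (U := R_UniformSpace) (fun w => k (dx f w)) z).
    { intros k hk; apply continuous_comp; [ now apply hcX | apply hk ]. }
    apply has_differential_of_parts.
    + apply (differentiable_pt_lim_of_partials (fun w => Re (f w)) (fun w => Re (dx f w))).
      * generalize (locally_unit_disk z hz); apply filter_imp; intros w hw.
        apply Derive_correct, (hex w hw).
      * apply Derive_correct, (hex z hz).
      * apply hre; intros w; apply continuous_fst.
    + apply (differentiable_pt_lim_of_partials (fun w => Im (f w)) (fun w => Im (dx f w))).
      * generalize (locally_unit_disk z hz); apply filter_imp; intros w hw.
        apply Derive_correct, (hex w hw).
      * apply Derive_correct, (hex z hz).
      * apply hre; intros w; apply continuous_snd.
  - intros u z hz; apply continuous_cvg; now apply hcX.
  - intros u z hz; apply continuous_cvg; now apply hcY.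
  - intros z hz; rewrite cross_dx_dy; now apply hJ.
Qed.

(** * Analytic functions along circles *)

Lemma analytic_has_differential (h : C -> C) (z : C) :
  analytic_on unit_disk h -> unit_disk z ->
  has_differential h z (C_derive h z) (Ci * C_derive h z).
Proof.
  intros hh hz eps he.
  destruct (C_derive_correct h z z (hh z hz)) as [_ hd].
  specialize (hd z (fun P h => h) (mkposreal eps he)).
  destruct hd as [[dl hdl] hd].
  exists dl; split; trivial; intros u hu.
  specialize (hd (z + u)%C).
  change (Cmod (z + u - z)%C < dl ->
    Cmod (h (z + u)%C - h z - (z + u - z) * C_derive h z)%C <= eps * Cmod (z + u - z)%C) in hd.
  replace (z + u - z)%C with u in hd by ring.
  (* The Cauchy-Riemann equations: a real differential with these partials is multiplication by the
     complex derivative. *)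
  replace (dlin (C_derive h z) (Ci * C_derive h z) u) with (u * C_derive h z)%C
    by (unfold dlin; destruct u, (C_derive h z); apply injective_projections; simpl; ring).
  now apply hd.
Qed.

Lemma is_derive_inner_analytic_rot (h : C -> C) (k z : C) :
  analytic_on unit_disk h -> unit_disk z ->
  is_derive (fun t => inner k (h (rot t z))) 0 (inner k (C_derive h z * (Ci * z))).
Proof.
  intros hh hz.
  replace (C_derive h z * (Ci * z))%C with (dlin (C_derive h z) (Ci * C_derive h z) (Ci * z))
    by (unfold dlin; destruct z, (C_derive h _); apply injective_projections; simpl; ring).
  apply is_derive_inner_comp.
  - rewrite rot_0; now apply analytic_has_differential.
  - unfold rot; simpl; auto_derive; trivial; rewrite sin_0, cos_0; unfold Re, Im; ring.
  - unfold rot; simpl; auto_derive; trivial; rewrite sin_0, cos_0; unfold Re, Im; ring.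
Qed.

(** Moving the conjugation to the test vector lets the terms [Cconj g] be differentiated through the
    analytic [g]. *)
Lemma inner_conj_r (k v : C) : inner k (Cconj v) = inner (Cconj k) v.
Proof. destruct k, v; unfold inner; simpl; ring. Qed.

Lemma inner_sum_n_m (k : C) (a : nat -> C) (n m : nat) :
  inner k (sum_n_m a n m) = sum_n_m (fun j => inner k (a j)) n m.
Proof.
  assert (h0 : inner k (RtoC 0) = 0) by (unfold inner; simpl; ring).
  induction m as [|m IH].
  - destruct n; [ now rewrite !sum_n_n | now rewrite !sum_n_m_zero by lia ].
  - destruct (Compare_dec.le_lt_dec n (S m)).
    + rewrite !sum_n_Sm by trivial; rewrite <- IH; apply inner_plus_r.
    + now rewrite !sum_n_m_zero by trivial.
Qed.

Lemma is_derive_sum_n_m (F : nat -> R -> R) (l : nat -> R) (x : R) (n m : nat) :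
  (forall j, (n <= j <= m)%nat -> is_derive (F j) x (l j)) ->
  is_derive (fun t => sum_n_m (fun j => F j t) n m) x (sum_n_m l n m).
Proof.
  induction m as [|m IH]; intros hF.
  - destruct n.
    + rewrite sum_n_n; apply is_derive_ext with (F O); [ intros; now rewrite sum_n_n | ].
      apply hF; lia.
    + rewrite sum_n_m_zero by lia.
      apply is_derive_ext with (fun _ => 0); [ intros; now rewrite sum_n_m_zero by lia | ].
      apply @is_derive_const.
  - destruct (Compare_dec.le_lt_dec n (S m)).
    + rewrite sum_n_Sm by trivial.
      apply is_derive_ext with (fun t => plus (sum_n_m (fun j => F j t) n m) (F (S m) t)).
      { intros t; now rewrite sum_n_Sm. }
      apply @is_derive_plus; [ apply IH; intros; apply hF; lia | apply hF; lia ].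
    + rewrite sum_n_m_zero by trivial.
      apply is_derive_ext with (fun _ => 0); [ intros; now rewrite sum_n_m_zero by lia | ].
      apply @is_derive_const.
Qed.

(** Differentiating along circles ignores the radial factors [|z|^(2(k-1))]. *)
Lemma inner_angular_sum (p : nat) (Phi : C -> C) (F h g : nat -> C -> C)
  (hPhi : immersion Phi (dx Phi) (dy Phi))
  (hsum : forall z : C, unit_disk z ->
     Phi z = sum_n_m (fun k : nat =>
               (RtoC (Cmod z ^ (2 * (k - 1))) * F (p - k + 1)%nat z)%C) 1 p)
  (hFhg : forall k : nat, (1 <= k <= p)%nat -> forall z : C, unit_disk z ->
     F (p - k + 1)%nat z =
       (h (p - k + 1)%nat z + Cconj (g (p - k + 1)%nat z))%C)
  (hh : forall k : nat, (1 <= k <= p)%nat ->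
     analytic_on unit_disk (h (p - k + 1)%nat))
  (hg : forall k : nat, (1 <= k <= p)%nat ->
     analytic_on unit_disk (g (p - k + 1)%nat)) (z k : C) :
  unit_disk z ->
  inner k (Ci * angular (dx Phi) (dy Phi) z) =
  sum_n_m (fun j => Cmod z ^ (2 * (j - 1)) *
    (inner k (C_derive (h (p - j + 1)%nat) z * (Ci * z))
     + inner (Cconj k) (C_derive (g (p - j + 1)%nat) z * (Ci * z)))) 1 p.
Proof.
  intros hz.
  assert (h1 := is_derive_inner_rot Phi _ _ hPhi k z 0 hz).
  rewrite rot_0 in h1; apply is_derive_unique in h1; rewrite <- h1.
  apply is_derive_unique.
  apply is_derive_ext with (fun t => sum_n_m (fun j => Cmod z ^ (2 * (j - 1)) *
    (inner k (h (p - j + 1)%nat (rot t z))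
     + inner (Cconj k) (g (p - j + 1)%nat (rot t z)))) 1 p).
  - intros t.
    assert (ht : unit_disk (rot t z)) by (unfold unit_disk, disk; now rewrite Cmod_rot).
    rewrite (hsum _ ht), inner_sum_n_m; apply sum_n_m_ext_loc; intros j hj.
    rewrite inner_scal_r, Cmod_rot, (hFhg j hj _ ht), inner_plus_r.
    now rewrite inner_conj_r.
  - apply is_derive_sum_n_m; intros j hj; apply is_derive_scal, @is_derive_plus.
    + apply is_derive_inner_analytic_rot; trivial; now apply hh.
    + apply is_derive_inner_analytic_rot; trivial; now apply hg.
Qed.

Theorem theorem3 (p : nat) (hp : (1 <= p)%nat)
  (alpha : R) (halpha : 0 <= alpha < 1)
  (Phi : C -> C) (F h g : nat -> C -> C)
  (hPhi : p_harmonic p unit_disk Phi)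
  (hPhi0 : Phi (RtoC 0) = RtoC 0)
  (hsum : forall z : C, unit_disk z ->
     Phi z = sum_n_m (fun k : nat =>
               (RtoC (Cmod z ^ (2 * (k - 1))) * F (p - k + 1)%nat z)%C) 1 p)
  (hF : forall k : nat, (1 <= k <= p)%nat ->
     harmonic unit_disk (F (p - k + 1)%nat))
  (hFhg : forall k : nat, (1 <= k <= p)%nat -> forall z : C, unit_disk z ->
     F (p - k + 1)%nat z =
       (h (p - k + 1)%nat z + Cconj (g (p - k + 1)%nat z))%C)
  (hh : forall k : nat, (1 <= k <= p)%nat ->
     analytic_on unit_disk (h (p - k + 1)%nat))
  (hg : forall k : nat, (1 <= k <= p)%nat ->
     analytic_on unit_disk (g (p - k + 1)%nat))
  (hJ : forall z : C, unit_disk z -> jacobian Phi z > 0) :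
  fully_accessible alpha Phi <->
  (forall z : C, unit_disk z ->
     sum_n_m (fun k : nat =>
        Cmod z ^ (2 * (k - 1)) *
        Re (z * (C_derive (h (p - k + 1)%nat) z * Cconj (Phi z)
                 - C_derive (g (p - k + 1)%nat) z * Phi z))%C) 1 p
     >= sin (alpha * PI / 2) * Cmod (Phi z) * L_fun p h g z).
Proof.
  assert (himm := p_harmonic_immersion p Phi hp hPhi hJ).
  set (W := angular (dx Phi) (dy Phi)).
  assert (hang := inner_angular_sum p Phi F h g himm hsum hFhg hh hg).
  assert (hA : forall z, unit_disk z -> A_fun p h g z = Re (W z)).
  (* The derivative along the circle is [Ci * W], so the test vector [Ci] extracts [Re W]; in the
     same way [-1] extracts [Im W] below. *)
  { intros z hz; transitivity (inner Ci (Ci * W z)); [ | unfold inner; simpl; ring ].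
    unfold W; rewrite (hang z Ci hz).
    transitivity (inner (Cconj z) (sum_n_m (fun k : nat =>
      RtoC (Cmod z ^ (2 * (k - 1))) *
      (C_derive (h (p - k + 1)%nat) z - C_derive (g (p - k + 1)%nat) z))%C 1 p)).
    { unfold A_fun; set (S := sum_n_m _ _ _); unfold inner; destruct z, S; simpl; ring. }
    rewrite inner_sum_n_m; apply sum_n_m_ext; intros j; rewrite inner_scal_r; f_equal.
    unfold inner; destruct z, (C_derive (h _) _), (C_derive (g _) _); simpl; ring. }
  assert (hB : forall z, unit_disk z -> B_fun p h g z = Im (W z)).
  { intros z hz; transitivity (inner (RtoC (-1)) (Ci * W z)); [ | unfold inner; simpl; ring ].
    unfold W; rewrite (hang z (RtoC (-1)) hz).
    transitivity (inner (Ci * Cconj z) (sum_n_m (fun k : nat =>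
      RtoC (Cmod z ^ (2 * (k - 1))) *
      (C_derive (h (p - k + 1)%nat) z + C_derive (g (p - k + 1)%nat) z))%C 1 p)).
    { unfold B_fun; set (S := sum_n_m _ _ _); unfold inner; destruct z, S; simpl; ring. }
    rewrite inner_sum_n_m; apply sum_n_m_ext; intros j; rewrite inner_scal_r; f_equal.
    unfold inner; destruct z, (C_derive (h _) _), (C_derive (g _) _); simpl; ring. }
  assert (hL : forall z, unit_disk z -> L_fun p h g z = Cmod (W z)).
  { intros z hz; unfold L_fun; rewrite hA, hB by trivial; reflexivity. }
  assert (hlhs : forall z, unit_disk z ->
    sum_n_m (fun k : nat =>
        Cmod z ^ (2 * (k - 1)) *
        Re (z * (C_derive (h (p - k + 1)%nat) z * Cconj (Phi z)
                 - C_derive (g (p - k + 1)%nat) z * Phi z))%C) 1 p = inner (W z) (Phi z)).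
  (* The test vector [Ci * Phi z] is used because multiplying both arguments by [Ci] preserves the
     inner product. *)
  { intros z hz; transitivity (inner (Ci * Phi z) (Ci * W z));
      [ | unfold inner; destruct (W z), (Phi z); simpl; ring ].
    unfold W; rewrite (hang z _ hz); apply sum_n_m_ext; intros j; f_equal.
    unfold inner; destruct z, (Phi _), (C_derive (h _) _), (C_derive (g _) _); simpl; ring. }
  split.
  - intros hfull z hz; rewrite hlhs, hL by trivial.
    apply Rle_ge, (accessible_angle Phi _ _ himm); trivial.
    intros r hr; apply hfull; lra.
  - intros hineq r hr; apply (immersion_accessible Phi _ _ himm); trivial.
    intros z hz; specialize (hineq z hz); rewrite hlhs, hL in hineq by trivial.
    now apply Rge_le.
Qed.
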